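(* For all terms $M,N$ of the $\partial\lambda$-calculus with tests and every repetition-free list of variables $\vec x$ containing the free variables of $M$ and $N$: $$\llbracket M\rrbracket_{\vec x}\subseteq\llbracket N\rrbracket_{\vec x}\iff M\sqsubseteq^{\tau!}_{\mathcal O}N.$$
   Context: Syntax of the $\partial\lambda$-calculus with tests. Terms $M,N,L$, bags $P$, tests $V,W$: $M::=x\mid\lambda x.M\mid MP\mid\bar\tau(V)$, $P::=[L_1,\dots,L_k,\mathbb N^{!}]$, $V::=\tau[L_1,\dots,L_k]$ ($k\ge0$), where $\mathbb N$ is a finite sum of terms; up to $\alpha$-equivalence. Sums of each sort are finite formal sums with idempotent addition (finite sets), $0$ the empty sum. Bag union: $[L_1,\dots,L_k,\mathbb N^!]\uplus[L'_1,\dots,L'_h,\mathbb M^!]=[L_1,\dots,L_k,L'_1,\dots,L'_h,(\mathbb N+\mathbb M)^!]$, with neutral element $[0^!]$; we write $[L_1,\dots,L_k]$ for $[L_1,\dots,L_k,0^!]$. For tests, $\varepsilon:=\tau[\,]$ and $V\mid W$ is multiset union. Constructors are extended to sums multilinearly (e.g. $\lambda x.\sum_iM_i=\sum_i\lambda x.M_i$, $(\sum_iM_i)(\sum_jP_j)=\sum_{i,j}M_iP_j$, $[\sum_iL_i]\uplus P=\sum_i[L_i]\uplus P$, $\tau[\sum_iM_i]\mid V=\sum_i\tau[M_i]\mid V$; constructors applied to $0$ give $0$), except that the promoted component $\mathbb N^!$ is not distributed: $[\vec L,(\mathbb N+\mathbb M)^!]$ is not $[\vec L,\mathbb N^!]+[\vec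 L,\mathbb M^!]$. $A\{\mathbb N/x\}$ replaces every free occurrence of $x$ by $\mathbb N$ (then using these conventions). Linear substitution: $x\langle N/x\rangle=N$, $y\langle N/x\rangle=0$ ($y\neq x$), $(\lambda y.M)\langle N/x\rangle=\lambda y.M\langle N/x\rangle$, $(MP)\langle N/x\rangle=M\langle N/x\rangle P+M(P\langle N/x\rangle)$, $\bar\tau(V)\langle N/x\rangle=\bar\tau(V\langle N/x\rangle)$, $\tau[L_1,\dots,L_k]\langle N/x\rangle=\sum_i\tau[L_1,\dots,L_i\langle N/x\rangle,\dots,L_k]$, $[L_1,\dots,L_k,\mathbb N^!]\langle N/x\rangle=\sum_i[L_1,\dots,L_i\langle N/x\rangle,\dots,L_k,\mathbb N^!]+[L_1,\dots,L_k,\mathbb N\langle N/x\rangle,\mathbb N^!]$, extended bilinearly to sums. For $P=[L_1,\dots,L_k]$ (no promoted part) with $x$ not free in $P$, $A\langle P/x\rangle:=A\langle L_1/x\rangle\cdots\langle L_k/x\rangle$, and for lists $A\langle\vec P/\vec x\rangle:=A\langle P_1/x_1\rangle\cdots\langle P_n/x_n\rangle$. Reduction rules: $(\lambda x.M)[L_1,\dots,L_k,\mathbb N^!]\to M\langle[L_1,\dots,L_k]/x\rangle\{\mathbb N/x\}$ ($x$ not free in the $L_i$); $\bar\tau(V)[L_1,\dots,L_k,\mathbb N^!]\to\bar\tau(V)$ if $k=0$ and $\to0$ otherwise; $\tau[\lambda x.M]\mid V\to\tau[M\{0/x\}]\mid V$; $\tau[\bar\tau(V)]\mid W\to V\mid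 W$. The relation $\to$ is their closure under all syntactic positions (including $[(M+\mathbb N)^!]\uplus P\to[(\mathbb M+\mathbb N)^!]\uplus P$ when $M\to\mathbb M$) and under sums ($A+\mathbb B\to\mathbb A+\mathbb B$ if $A\to\mathbb A$); $\twoheadrightarrow$ is its reflexive-transitive closure. A test $V$ converges if $V\twoheadrightarrow\varepsilon+\mathbb V$ for some (possibly empty) sum $\mathbb V$. Term-contexts $D::=[\cdot]\mid\lambda x.D\mid DP\mid M[D,L_1,\dots,L_k,\mathbb N^!]\mid M[L_1,\dots,L_k,(D+\mathbb N)^!]\mid\bar\tau(C)$, test-contexts $C::=\tau[D,L_1,\dots,L_k]$; $C[M]$ replaces the hole by $M$ allowing capture. $M\sqsubseteq^{\tau!}_{\mathcal O}N$ iff for every test-context $C$ with $C[M],C[N]$ closed, if $C[M]$ converges then $C[N]$ converges. The model $\mathcal D$. $\mathcal M_f(S)$ = finite multisets over $S$. $D_0=\emptyset$, $D_{n+1}$ = set of $\mathbb N$-indexed sequences $(a_1,a_2,\dots)$ of elements of $\mathcal M_f(D_n)$ with all but finitely many empty, $\mathcal D=\bigcup_nD_n$; $a::(a_1,a_2,\dots):=(a,a_1,a_2,\dots)$, $*:=([\,],[\,],\dots)$; $\uplus$ on tuples is componentwise. For a repetition-free list $\vec x=x_1,\dots,x_n$ containing the free variables: $\llbracket x_i\rrbracket_{\vec x}=\{(([\,],\dots,[\alpha],\dots,[\,]),\alpha):\alpha\in\mathcal D\}$ ($[\alpha]$ in position $i$); $\llbracket\lambda y.M\rrbracket_{\vec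 x}=\{(\vec a,b::\alpha):((\vec a,b),\alpha)\in\llbracket M\rrbracket_{\vec x,y}\}$; $\llbracket MP\rrbracket_{\vec x}=\{(\vec a_1\uplus\vec a_2,\alpha):\exists b\,(\vec a_1,b::\alpha)\in\llbracket M\rrbracket_{\vec x},(\vec a_2,b)\in\llbracket P\rrbracket_{\vec x}\}$; $\llbracket\bar\tau(V)\rrbracket_{\vec x}=\{(\vec a,* ):\vec a\in\llbracket V\rrbracket_{\vec x}\}$; $\llbracket[L_1,\dots,L_k,\mathbb N^!]\rrbracket_{\vec x}=\{(\biguplus_{r=1}^{k+m}\vec a_r,[\beta_1,\dots,\beta_{k+m}]):m\ge0,(\vec a_j,\beta_j)\in\llbracket L_j\rrbracket_{\vec x}\ (j\le k),(\vec a_i,\beta_i)\in\llbracket\mathbb N\rrbracket_{\vec x}\ (k<i\le k+m)\}$; $\llbracket\tau[L_1,\dots,L_k]\rrbracket_{\vec x}=\{\biguplus_i\vec a_i:(\vec a_i,* )\in\llbracket L_i\rrbracket_{\vec x}\}$; sums are interpreted as unions. *)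

(* Defs.v *)
From HB Require Import structures.
From mathcomp Require Import all_boot.
From mathcomp Require Import finmap multiset classical_sets.
From Stdlib Require List Permutation.

Set Implicit Arguments.
Unset Strict Implicit.
Unset Printing Implicit Defensive.

Local Open Scope classical_set_scope.
Local Open Scope mset_scope.

(** * Syntax

   Variables are natural numbers, and alpha-classes are represented by de
   Bruijn terms: [Lam] binds index 0, and under [k] binders the index [i + k]
   denotes the free variable [i].  Hence every de Bruijn term represents
   exactly one alpha-class, and the named abstraction is [lam x M] below.

   Multisets and finite (idempotent) sums are represented by lists; the
   identifications this calls for are the relations [tm_eqv], [bag_eqv],
   [tst_eqv] and [sum_eqv], and reduction is taken modulo them.  [nil] is the
   empty sum 0 and concatenation is +. *)

Inductive term : Type :=
| Var of nat
| Lam of term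
| App of term & bag
| TauBar of test
with bag : Type :=
| Bag of seq term & seq term (* [Bag L N] is [L_1, ..., L_k, N^!] *)
with test : Type :=
| Tau of seq term.

Definition eps : test := Tau [::].

(* Equality of finite sums, given the equality [E] of summands. *)
Definition sum_eqv (T : Type) (E : T -> T -> Prop) (S S' : seq T) : Prop :=
  (forall A, List.In A S -> exists2 A', List.In A' S' & E A A') /\
  (forall A', List.In A' S' -> exists2 A, List.In A S & E A A').

Inductive tm_eqv : term -> term -> Prop :=
| tm_eqv_refl M : tm_eqv M M
| tm_eqv_sym M M' : tm_eqv M M' -> tm_eqv M' M
| tm_eqv_trans M M' M'' : tm_eqv M M' -> tm_eqv M' M'' -> tm_eqv M M''
| tm_eqv_lam M M' : tm_eqv M M' -> tm_eqv (Lam M) (Lam M')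
| tm_eqv_app M M' P P' :
    tm_eqv M M' -> bag_eqv P P' -> tm_eqv (App M P) (App M' P')
| tm_eqv_taubar V V' : tst_eqv V V' -> tm_eqv (TauBar V) (TauBar V')
with bag_eqv : bag -> bag -> Prop :=
| bag_eqv_refl P : bag_eqv P P
| bag_eqv_sym P P' : bag_eqv P P' -> bag_eqv P' P
| bag_eqv_trans P P' P'' : bag_eqv P P' -> bag_eqv P' P'' -> bag_eqv P P''
| bag_eqv_lin M M' L N : tm_eqv M M' -> bag_eqv (Bag (M :: L) N) (Bag (M' :: L) N)
| bag_eqv_prom M M' L N : tm_eqv M M' -> bag_eqv (Bag L (M :: N)) (Bag L (M' :: N))
| bag_eqv_perm L L' N : Permutation.Permutation L L' -> bag_eqv (Bag L N) (Bag L' N)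
| bag_eqv_set L N N' : List.incl N N' -> List.incl N' N -> bag_eqv (Bag L N) (Bag L N')
with tst_eqv : test -> test -> Prop :=
| tst_eqv_refl V : tst_eqv V V
| tst_eqv_sym V V' : tst_eqv V V' -> tst_eqv V' V
| tst_eqv_trans V V' V'' : tst_eqv V V' -> tst_eqv V' V'' -> tst_eqv V V''
| tst_eqv_elt M M' L : tm_eqv M M' -> tst_eqv (Tau (M :: L)) (Tau (M' :: L))
| tst_eqv_perm L L' : Permutation.Permutation L L' -> tst_eqv (Tau L) (Tau L').

(** ** Variables *)

Definition upren (f : nat -> nat) (i : nat) : nat :=
  if i is j.+1 then (f j).+1 else 0.

Fixpoint rename (f : nat -> nat) (M : term) {struct M} : term :=
  match M with
  | Var x => Var (f x)
  | Lam M => Lam (rename (upren f) M)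
  | App M P => App (rename f M) (rename_bag f P)
  | TauBar V => TauBar (rename_test f V)
  end
with rename_bag (f : nat -> nat) (P : bag) {struct P} : bag :=
  match P with Bag L N => Bag (map (rename f) L) (map (rename f) N) end
with rename_test (f : nat -> nat) (V : test) {struct V} : test :=
  match V with Tau L => Tau (map (rename f) L) end.

Definition shift : term -> term := rename S.
(* Only applied to terms in which the index 0 does not occur free. *)
Definition lower : term -> term := rename predn.

(* The named abstraction "lambda x. M". *)
Definition lam (x : nat) (M : term) : term :=
  Lam (rename (fun y => if y == x then 0 else y.+1) M).

Fixpoint fv (M : term) {struct M} : seq nat :=
  match M with
  | Var x => [:: x]
  | Lam M => [seq i.-1 | i <- fv M & i != 0]
  | App M P => fv M ++ fv_bag P
  | TauBar V => fv_test V
  end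
with fv_bag (P : bag) {struct P} : seq nat :=
  match P with Bag L N => flatten (map fv L) ++ flatten (map fv N) end
with fv_test (V : test) {struct V} : seq nat :=
  match V with Tau L => flatten (map fv L) end.

Definition closed (V : test) : Prop := fv_test V = [::].

(** ** Substitutions *)

(* Multilinear expansion of [S_1, ..., S_k], each S_i a sum. *)
Definition choices (T : Type) (s : seq (seq T)) : seq (seq T) :=
  foldr (fun S acc => [seq x :: l | x <- S, l <- acc]) [:: [::]] s.

(* [subst x S M] is M{S/x}; the name x is not removed from the scope. *)
Fixpoint subst (x : nat) (S : seq term) (M : term) {struct M} : seq term :=
  match M with
  | Var y => if y == x then S else [:: Var y]
  | Lam M => map Lam (subst x.+1 (map shift S) M)
  | App M P => [seq App M' P' | M' <- subst x S M, P' <- subst_bag x S P]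
  | TauBar V => map TauBar (subst_test x S V)
  end
with subst_bag (x : nat) (S : seq term) (P : bag) {struct P} : seq bag :=
  match P with
  | Bag L N =>
      [seq Bag L' (flatten (map (subst x S) N)) | L' <- choices (map (subst x S) L)]
  end
with subst_test (x : nat) (S : seq term) (V : test) {struct V} : seq test :=
  match V with Tau L => map Tau (choices (map (subst x S) L)) end.

(* The sum over i of [L_1, ..., f L_i, ..., L_k]. *)
Definition derive_seq (T : Type) (f : T -> seq T) : seq T -> seq (seq T) :=
  fix derive_rec (L : seq T) : seq (seq T) :=
    if L is M :: L' then
      [seq M' :: L' | M' <- f M] ++ [seq M :: L'' | L'' <- derive_rec L']
    else [::].

(* [lsubst x A M] is M<A/x>. *)
Fixpoint lsubst (x : nat) (A : term) (M : term) {struct M} : seq term :=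
  match M with
  | Var y => if y == x then [:: A] else [::]
  | Lam M => map Lam (lsubst x.+1 (shift A) M)
  | App M P =>
      [seq App M' P | M' <- lsubst x A M] ++ [seq App M P' | P' <- lsubst_bag x A P]
  | TauBar V => map TauBar (lsubst_test x A V)
  end
with lsubst_bag (x : nat) (A : term) (P : bag) {struct P} : seq bag :=
  match P with
  | Bag L N =>
      [seq Bag L' N | L' <- derive_seq (lsubst x A) L]
      ++ [seq Bag (M :: L) N | M <- flatten (map (lsubst x A) N)]
  end
with lsubst_test (x : nat) (A : term) (V : test) {struct V} : seq test :=
  match V with Tau L => map Tau (derive_seq (lsubst x A) L) end.

(* S<L_1/x>...<L_k/x> *)
Definition lsubsts (x : nat) (L : seq term) (S : seq term) : seq term :=
  foldl (fun S A => flatten (map (lsubst x A) S)) S L.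

(** ** Reduction *)

(* Contractum of (lambda. M)[L, N^!]: the bound variable is the fresh variable
   0 once the free variables of the bag are shifted. *)
Definition beta (M : term) (L N : seq term) : seq term :=
  map lower
    (flatten (map (subst 0 (map shift N)) (lsubsts 0 (map shift L) [:: M]))).

Inductive tm_step : term -> seq term -> Prop :=
| step_beta M L N : tm_step (App (Lam M) (Bag L N)) (beta M L N)
| step_taubar_nil V N : tm_step (App (TauBar V) (Bag [::] N)) [:: TauBar V]
| step_taubar_cons V M L N : tm_step (App (TauBar V) (Bag (M :: L) N)) [::]
| step_lam M S : tm_step M S -> tm_step (Lam M) (map Lam S)
| step_app_l M S P : tm_step M S -> tm_step (App M P) [seq App M' P | M' <- S]
| step_app_r M P S : bag_step P S -> tm_step (App M P) [seq App M P' | P' <- S]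
| step_taubar V S : tst_step V S -> tm_step (TauBar V) (map TauBar S)
| step_tm_eqv M M' S S' :
    tm_eqv M M' -> tm_step M' S' -> sum_eqv tm_eqv S' S -> tm_step M S
with bag_step : bag -> seq bag -> Prop :=
| step_bag_lin M S L N :
    tm_step M S -> bag_step (Bag (M :: L) N) [seq Bag (M' :: L) N | M' <- S]
| step_bag_prom M S L N :
    tm_step M S -> bag_step (Bag L (M :: N)) [:: Bag L (S ++ N)]
| step_bag_eqv P P' S S' :
    bag_eqv P P' -> bag_step P' S' -> sum_eqv bag_eqv S' S -> bag_step P S
with tst_step : test -> seq test -> Prop :=
| step_tau_lam M L :
    tst_step (Tau (Lam M :: L))
      [seq Tau (M' :: L) | M' <- map lower (subst 0 [::] M)]
| step_tau_taubar K L : tst_step (Tau (TauBar (Tau K) :: L)) [:: Tau (K ++ L)]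
| step_tau M S L :
    tm_step M S -> tst_step (Tau (M :: L)) [seq Tau (M' :: L) | M' <- S]
| step_tst_eqv V V' S S' :
    tst_eqv V V' -> tst_step V' S' -> sum_eqv tst_eqv S' S -> tst_step V S.

(* One step on sums of tests: A + B -> A' + B when A -> A'. *)
Definition tests_step (S S' : seq test) : Prop :=
  exists V S1 R, [/\ sum_eqv tst_eqv S (V :: R), tst_step V S1
                   & sum_eqv tst_eqv (S1 ++ R) S'].

Inductive tests_steps : seq test -> seq test -> Prop :=
| steps_refl S S' : sum_eqv tst_eqv S S' -> tests_steps S S'
| steps_trans S S' S'' : tests_step S S' -> tests_steps S' S'' -> tests_steps S S''.

Definition converges (V : test) : Prop :=
  exists S, tests_steps [:: V] (eps :: S).

(** ** Contexts and observational preorder *)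

(* [CLam x D] is "lambda x. D" with a named x, so that plugging captures the
   free variable x of the plugged term. *)
Inductive tmctx : Type :=
| CHole
| CLam of nat & tmctx
| CApp of tmctx & bag
| CLin of term & tmctx & seq term & seq term  (* M [D, L, N^!] *)
| CProm of term & seq term & tmctx & seq term (* M [L, (D + N)^!] *)
| CTauBar of tstctx
with tstctx : Type :=
| CTau of tmctx & seq term.

Fixpoint plug (D : tmctx) (M : term) {struct D} : term :=
  match D with
  | CHole => M
  | CLam x D => lam x (plug D M)
  | CApp D P => App (plug D M) P
  | CLin M' D L N => App M' (Bag (plug D M :: L) N)
  | CProm M' L D N => App M' (Bag L (plug D M :: N))
  | CTauBar C => TauBar (plug_test C M)
  end
with plug_test (C : tstctx) (M : term) {struct C} : test :=
  match C with CTau D L => Tau (plug D M :: L) end.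

Definition obs_le (M N : term) : Prop :=
  forall C : tstctx, closed (plug_test C M) -> closed (plug_test C N) ->
    converges (plug_test C M) -> converges (plug_test C N).

(** * The relational model

   An element of the model is a sequence of finite multisets, all but finitely
   many empty; it is represented by the list [PCons a_1 (PCons a_2 ... PStar)]
   with no trailing empty multiset, a multiset being represented by a sorted
   list.  [pcanon] selects these unique representatives. *)

Inductive pre : Type :=
| PStar
| PCons of seq pre & pre.

Fixpoint pre_encode (t : pre) : GenTree.tree unit :=
  match t with
  | PStar => GenTree.Leaf tt
  | PCons b a => GenTree.Node 0 (pre_encode a :: map pre_encode b)
  end.

Fixpoint pre_decode (t : GenTree.tree unit) : pre :=
  match t with
  | GenTree.Node _ (a :: b) => PCons (map pre_decode b) (pre_decode a)
  | _ => PStar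
  end.

Lemma pre_nested_ind (P : pre -> Prop) :
  P PStar ->
  (forall b a, List.Forall P b -> P a -> P (PCons b a)) -> forall t, P t.
Proof.
move=> P0 PS; fix IH 1; case=> [|b a]; first exact: P0.
apply: PS; last exact: IH.
by elim: b => [|x b IHb]; constructor.
Qed.

Lemma pre_encodeK : cancel pre_encode pre_decode.
Proof.
elim/pre_nested_ind => [//|b a Hb Ha] /=; rewrite Ha; congr PCons.
by elim: b Hb => [//|x b IHb] H /=; inversion H; subst; congr cons => //; apply: IHb.
Qed.

HB.instance Definition _ := Countable.copy pre (can_type pre_encodeK).

Definition pre_le : rel pre := relpre choice.pickle leq.

Fixpoint pcanon (t : pre) : bool :=
  match t with
  | PStar => true
  | PCons b a =>
      [&& sorted pre_le b, all pcanon b, pcanon a & (b != [::]) || (a != PStar)]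
  end.

Record D : Type := MkD { dval : pre; dvalP : pcanon dval }.

HB.instance Definition _ := [isSub for dval].
HB.instance Definition _ := [Countable of D by <:].

Definition star : D := @MkD PStar isT.

Definition pcons (b : seq pre) (a : pre) : pre :=
  if (b == [::]) && (a == PStar) then PStar else PCons b a.

Lemma pre_le_total : total pre_le.
Proof. by move=> x y; apply: leq_total. Qed.

Lemma pre_le_trans : transitive pre_le.
Proof. by move=> x y z; apply: leq_trans. Qed.

Lemma pre_le_anti : antisymmetric pre_le.
Proof. by move=> x y /anti_leq /(pcan_inj choice.pickleK). Qed.

Lemma dconsP (b : {mset D}) (a : D) :
  pcanon (pcons (sort pre_le [seq dval x | x <- (b : seq D)]) (dval a)).
Proof.
rewrite /pcons; case: ifP => //= /negbT; rewrite negb_and => ->.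
rewrite (sort_sorted pre_le_total) dvalP all_sort andbT /=.
by apply/andP; split=> //; apply/allP => _ /mapP[x _ ->]; exact: dvalP.
Qed.

(* b :: (a_1, a_2, ...) := (b, a_1, a_2, ...) *)
Definition dcons (b : {mset D}) (a : D) : D := MkD (dconsP b a).

(* The next three facts determine D, with [dcons] and [star], up to unique
   isomorphism. *)
Lemma dcons0 : dcons mset0 star = star.
Proof.
by apply: val_inj; rewrite /= enum_mset0.
Qed.

Lemma dcons_inj b a b' a' : dcons b a = dcons b' a' -> b = b' /\ a = a'.
Proof.
move=> /(congr1 dval) /= E.
have pconsI s t s' t' : pcons s t = pcons s' t' -> s = s' /\ t = t'.
  rewrite /pcons; case: ifP => [/andP[/eqP-> /eqP->]|_];
    by case: ifP => [/andP[/eqP-> /eqP->]|_] // [].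
have [Es Ea] := pconsI _ _ _ _ E; split; last exact: val_inj.
rewrite -(seq_mset_id b) -(seq_mset_id b'); apply/eq_seq_msetP.
apply: (@perm_map_inj _ _ dval); first exact: val_inj.
apply/(perm_sortP pre_le_total pre_le_trans pre_le_anti); exact: Es.
Qed.

Lemma D_nested_ind (P : D -> Prop) :
  P star ->
  (forall (b : {mset D}) (a : D),
      (forall x, x \in b -> P x) -> P a -> P (dcons b a)) ->
  forall a, P a.
Proof.
move=> P0 PS.
suff H t : forall c : pcanon t, P (MkD c) by case=> t c; apply: H.
elim/pre_nested_ind: t => [c|s a IHs IHa c].
  by have -> : MkD c = star by apply: val_inj.
have /= /and4P[so al ca ne] := c.
pose s' : seq D := pmap insub s.
have Es : map dval s' = s.
  rewrite /s'; elim: s al {c so ne IHs s'} => //= x s IH /andP[cx /IH Hs].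
  by rewrite insubT /= Hs.
have -> : MkD c = dcons (seq_mset s') (MkD ca).
  apply: val_inj => /=.
  have -> : sort pre_le [seq dval x | x <- (seq_mset s' : seq D)] = s.
    rewrite -[RHS](sorted_sort pre_le_trans so) -{1}Es.
    apply/(perm_sortP pre_le_total pre_le_trans pre_le_anti).
    by apply: perm_map; apply: perm_eq_seq_mset.
  rewrite /pcons; case: ifP => // /andP[/eqP s0 /eqP a0].
  by move: ne; rewrite s0 a0.
apply: PS; last exact: IHa.
move=> x; rewrite (perm_mem (perm_eq_seq_mset s')) => xs.
have {xs} : dval x \in s by rewrite -Es; apply: map_f.
elim: s IHs {c so al ne s' Es} => //= y s IH H; inversion H; subst.
by rewrite inE => /predU1P[E|/IH]; [case: x {IH} E => u cu /= E; subst | apply].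
Qed.

(** ** Interpretation *)

Section Interpretation.
Variable n : nat.

Definition point := (n.-tuple {mset D} * D)%type.

Definition tadd (a b : n.-tuple {mset D}) : n.-tuple {mset D} :=
  [tuple tnth a i `+` tnth b i | i < n].

Definition tzero : n.-tuple {mset D} := [tuple mset0 | i < n].

Definition tsum (s : seq (n.-tuple {mset D})) : n.-tuple {mset D} :=
  foldr tadd tzero s.

Definition tunit (i : 'I_n) (x : D) : n.-tuple {mset D} :=
  [tuple if j == i then [mset x] else mset0 | j < n].

Definition sem_sum (T : Type) (Ss : seq (set T)) : set T := foldr setU set0 Ss.

(* Bag [L_1, ..., L_k, N^!], from the L_i and from N: [s] collects the k points
   chosen in the L_i, [t] the m points chosen in N. *)
Definition sem_bag_of (Ls : seq (set point)) (N : set point) :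
    set (n.-tuple {mset D} * {mset D}) :=
  [set p | exists s t : seq point,
     [/\ List.Forall2 (fun (L : set point) q => L q) Ls s,
         List.Forall N t,
         p.1 = tsum [seq q.1 | q <- s ++ t]
       & p.2 = seq_mset [seq q.2 | q <- s ++ t]]].

Definition sem_test_of (Ls : seq (set point)) : set (n.-tuple {mset D}) :=
  [set a | exists s : seq (n.-tuple {mset D}),
     List.Forall2 (fun (L : set point) c => L (c, star)) Ls s /\ a = tsum s].

End Interpretation.

Definition textend (T : Type) n (a : n.-tuple T) (b : T) : n.+1.-tuple T :=
  [tuple of rcons a b].

(* The list (x_1, ..., x_n, y) under an abstraction binding y. *)
Definition scope_lam n (xs : n.-tuple nat) : n.+1.-tuple nat :=
  textend [tuple of map S xs] 0.

Fixpoint sem n (xs : n.-tuple nat) (M : term) {struct M} : set (point n) :=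
  match M with
  | Var x => [set p | exists2 i, tnth xs i = x & p.1 = tunit i p.2]
  | Lam M =>
      [set p | exists b a, sem (scope_lam xs) M (textend p.1 b, a)
                           /\ p.2 = dcons b a]
  | App M P =>
      [set p | exists a1 a2 b, [/\ sem xs M (a1, dcons b p.2),
                                   sem_bag xs P (a2, b)
                                 & p.1 = tadd a1 a2]]
  | TauBar V => [set p | sem_test xs V p.1 /\ p.2 = star]
  end
with sem_bag n (xs : n.-tuple nat) (P : bag) {struct P} :
    set (n.-tuple {mset D} * {mset D}) :=
  match P with
  | Bag L N => sem_bag_of (map (sem xs) L) (sem_sum (map (sem xs) N))
  end
with sem_test n (xs : n.-tuple nat) (V : test) {struct V} :
    set (n.-tuple {mset D}) :=
  match V with Tau L => sem_test_of (map (sem xs) L) end.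

(* Main.v *)
Require Import Defs.
From mathcomp Require Import all_boot finmap multiset.
From mathcomp Require Import classical_sets.
From mathcomp Require Import zify.
From Stdlib Require List Permutation.

(** The interpretation is presented as a non-idempotent intersection type
    system whose judgements are the points (G, a) of the terms.  Linear and
    ordinary substitution act on derivations without changing their total size,
    so a reduction step only reflects points, while contracting a head redex
    lifts a derivation in the empty environment to a strictly smaller one of
    some summand of the contractum.  Hence a test with a point in the empty
    environment converges, by induction on the size, and a convergent test has
    such a point; as the interpretation is monotone for contexts, this yields
    the implication from left to right.  For the converse, tests make every
    point (G, a) definable: there is a test-context, closing the variables of G
    and applying the result to arguments read off a, such that filling its hole
    with M gives a convergent test exactly when (G, a) is a point of M. *)

Set Implicit Arguments.
Unset Strict Implicit.
Unset Printing Implicit Defensive.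

(** Environments are lists of typed variables rather than tuples indexed by a scope: going under a
    binder, renaming and context merging become [map] and concatenation up to permutation, and the
    empty environment is one object whatever the scope. Tuples return only when derivations are
    compared with [sem].

    A derivation uses each derivation of an argument exactly once, so it also selects, at every
    substitution, one summand of the resulting sum. Lifting a derivation follows this selection, and
    one selected summand is enough for convergence. Sizes are kept only along head steps, where they
    fall; a step at an arbitrary position may act on any number of copies of a promoted term, and
    there only the existence of a derivation is transported.

    The identity [[] :: * = *] is what makes the test rules agree with the types: a tested
    abstraction has its variable used at no type, and [TauBar V] accepts a bag without contribution.

    Definability is contravariant: probing for [b :: d] needs arguments with exactly the types in
    [b], while a term with that type must itself probe its argument at those types. The two
    constructions therefore call each other on the elements of [b]. *)

Lemma term_nested_ind (P : term -> Prop) :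
  (forall x, P (Var x)) ->
  (forall M, P M -> P (Lam M)) ->
  (forall M L N, P M -> (forall A, List.In A L -> P A) ->
     (forall A, List.In A N -> P A) -> P (App M (Bag L N))) ->
  (forall L, (forall A, List.In A L -> P A) -> P (TauBar (Tau L))) ->
  forall M, P M.
Proof.
move=> HV HL HA HT; fix IH 1.
(* The recursion on lists is a local [fix], so that the guard condition sees each call [IH B] on an
   element of a list as a call on a subterm. *)
pose IHs := fix IHL L A : List.In A L -> P A :=
  match L with
  | [::] => False_ind _
  | B :: L => fun H => match H with
                       | or_introl e => eq_ind B P (IH B) A e
                       | or_intror h => IHL L A h
                       end
  end.
case=> [x|M|M [L N]|[L]].
- exact: HV.
- exact: HL.
- exact: (HA _ _ _ (IH M) (IHs L) (IHs N)).
- exact: (HT _ (IHs L)).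
Qed.

(** * Membership in sums represented by lists *)

Lemma In_map T U (f : T -> U) s y :
  List.In y (map f s) <-> exists2 x, List.In x s & y = f x.
Proof.
elim: s => [|x s IH] /=; first by split=> [//|[]].
rewrite IH; split=> [[<-|[z zs ->]]|[z [<-|zs] ->]].
- by exists x; [left|].
- by exists z; [right|].
- by left.
- by right; exists z.
Qed.

Lemma In_cat T (s t : seq T) x : List.In x (s ++ t) <-> List.In x s \/ List.In x t.
Proof. exact: List.in_app_iff. Qed.

Lemma In_flatten T (ss : seq (seq T)) x :
  List.In x (flatten ss) <-> exists2 s, List.In s ss & List.In x s.
Proof.
elim: ss => [|s ss IH] /=; first by split=> [//|[]].
rewrite In_cat IH; split=> [[xs|[t ts xt]]|[t [<-|ts] xt]].
- by exists s; [left|].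
- by exists t; [right|].
- by left.
- by right; exists t.
Qed.

Lemma In_allpairs T U V (f : T -> U -> V) s t z :
  List.In z [seq f x y | x <- s, y <- t] <->
  exists x y, [/\ List.In x s, List.In y t & z = f x y].
Proof.
rewrite In_flatten; split=> [[l /In_map[x xs ->] /In_map[y yt ->]]|[x [y [xs yt ->]]]].
  by exists x, y.
by exists [seq f x y | y <- t]; apply/In_map; [exists x | exists y].
Qed.

Lemma In_choices T (ss : seq (seq T)) l :
  List.In l (choices ss) <-> List.Forall2 (fun s x => List.In x s) ss l.
Proof.
elim: ss l => [|s ss IH] l /=.
  split=> [[<-|//]|]; first by constructor.
  by move=> H; inversion H; left.
rewrite In_allpairs; split=> [[x [y [xs yss ->]]]|H].
  by constructor=> //; apply/IH.
inversion H; subst; exists y, l'; split=> //; by apply/IH.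
Qed.

Lemma In_derive_seq T (f : T -> seq T) s l :
  List.In l (derive_seq f s) <->
  exists s1 x s2 x', [/\ s = s1 ++ x :: s2, List.In x' (f x) & l = s1 ++ x' :: s2].
Proof.
elim: s l => [|x s IH] l /=.
  by split=> [//|[[|? ?] [? [? [? []]]]]].
rewrite In_cat !In_map; split.
  case=> [[x' fx ->]|[l' /IH[s1 [y [s2 [y' [-> fy ->]]]]] ->]].
    by exists [::], x, s, x'.
  by exists (x :: s1), y, s2, y'.
move=> [[|z s1] [y [s2 [y' /= [[? ?] fy ->]]]]]; subst; first by left; exists y'.
right; exists (s1 ++ y' :: s2); last by [].
by apply/IH; exists s1, y, s2, y'.
Qed.

Lemma Forall2_map_l T U V (R : U -> V -> Prop) (f : T -> U) s t :
  List.Forall2 R (map f s) t <-> List.Forall2 (fun x => R (f x)) s t.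
Proof.
elim: s t => [|x s IH] t /=; split=> H; inversion H; subst; constructor=> //; exact/IH.
Qed.

Lemma Forall2_split T U (R : T -> U -> Prop) s1 s2 t :
  List.Forall2 R (s1 ++ s2) t -> exists t1 t2,
    [/\ t = t1 ++ t2, List.Forall2 R s1 t1 & List.Forall2 R s2 t2].
Proof.
elim: s1 t => [|x s IH] t /= H; first by exists [::], t; split=> //; constructor.
inversion H as [|? y ? t' Rxy Rst]; subst; have [t1 [t2 [-> F1 F2]]] := IH _ Rst.
by exists (y :: t1), t2; split=> //; constructor.
Qed.

(** * Derivations and their inversion *)

Definition env := seq (nat * D).

Definition assign (x : nat) (b : seq D) : env := [seq (x, a) | a <- b].

Definition ren (f : nat -> nat) (G : env) : env := [seq (f p.1, p.2) | p <- G].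

Definition absent (x : nat) (G : env) : bool := x \notin [seq p.1 | p <- G].

(** A permutation of concatenations becomes a linear equation between the numbers of entries
    satisfying an arbitrary predicate, which [lia] solves from the same equations for the
    hypotheses. *)
Ltac perm_solve :=
  apply/permP;
  let p := fresh "p" in
  intro p;
  repeat match goal with H : is_true (perm_eq _ _) |- _ =>
    move/permP/(_ p): H end;
  rewrite /assign /ren ?map_cat /= ?count_cat /= ?count_cat; lia.

(* [G] stands for the tuple of multisets, [s] for the size of the derivation.
   The variable rule costs nothing, which makes sizes additive under
   substitution. *)
Inductive ty : nat -> env -> term -> D -> Prop :=
| ty_var G x a : perm_eq G [:: (x, a)] -> ty 0 G (Var x) a
| ty_lam s G M b a c :
    ty s (assign 0 b ++ ren S G) M a -> c = dcons (seq_mset b) a ->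
    ty s.+1 G (Lam M) c
| ty_app s s1 s2 G G1 G2 M L N K b a :
    ty s1 G1 M (dcons (seq_mset b) a) -> List.incl K N ->
    tys s2 G2 (L ++ K) b -> perm_eq G (G1 ++ G2) -> s = (s1 + s2).+1 ->
    ty s G (App M (Bag L N)) a
| ty_taubar s G L a :
    tys s G L (nseq (size L) star) -> a = star -> ty s.+1 G (TauBar (Tau L)) a
with tys : nat -> env -> seq term -> seq D -> Prop :=
| tys_nil : tys 0 [::] [::] [::]
| tys_cons s s1 s2 G G1 G2 M L a b :
    ty s1 G1 M a -> tys s2 G2 L b -> perm_eq G (G1 ++ G2) -> s = s1 + s2 ->
    tys s G (M :: L) (a :: b).

Lemma dcons_seq_inj b a b' a' :
  dcons (seq_mset b) a = dcons (seq_mset b') a' -> perm_eq b b' /\ a = a'.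
Proof. by move=> /dcons_inj[/eq_seq_msetP]. Qed.

Lemma dcons_nil_star : dcons (seq_mset [::]) star = star.
Proof. by rewrite -[RHS]dcons0 -(seq_mset_id mset0) enum_mset0. Qed.

Lemma dcons_seqE (c : D) : exists b a, c = dcons (seq_mset b) a.
Proof.
elim/D_nested_ind: c => [|b a _ _].
  by exists [::], star; rewrite dcons_nil_star.
by exists b, a; rewrite seq_mset_id.
Qed.

Lemma seq_mset_perm (T : choiceType) (b b' : seq T) :
  perm_eq b b' -> seq_mset b = seq_mset b'.
Proof. by move=> ?; apply/eq_seq_msetP. Qed.


(** [K] lists the copies of summands of [N] that are used, with repetition, one for each of the m
    points taken in the promoted sum. The list [b] only represents a multiset, whence the
    permutation. *)
Definition tybag (s : nat) (G : env) (P : bag) (b : seq D) : Prop :=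
  let: Bag L N := P in
  exists K b', [/\ List.incl K N, perm_eq b b' & tys s G (L ++ K) b'].

Definition tytest (s : nat) (G : env) (V : test) : Prop :=
  let: Tau L := V in tys s G L (nseq (size L) star).

Lemma ty_varE s G x a :
  ty s G (Var x) a <-> s = 0 /\ perm_eq G [:: (x, a)].
Proof.
split=> [T|[-> p]]; last by constructor.
by inversion T; subst; split.
Qed.

Lemma tys_nilE s G b : tys s G [::] b <-> [/\ s = 0, G = [::] & b = [::]].
Proof.
split=> [T|[-> -> ->]]; last by constructor.
by inversion T.
Qed.

Lemma tys_consE s G M L c : tys s G (M :: L) c <->
  exists s1 s2 G1 G2 a b, [/\ ty s1 G1 M a, tys s2 G2 L b,
    perm_eq G (G1 ++ G2), s = s1 + s2 & c = a :: b].
Proof.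
split=> [T|[s1 [s2 [G1 [G2 [a [b [T1 T2 p -> ->]]]]]]]].
  by inversion T as [|? s1 s2 ? G1 G2 ? ? a b]; exists s1, s2, G1, G2, a, b.
exact: tys_cons T1 T2 p erefl.
Qed.

Lemma tys_perm_env s G G' L b : perm_eq G G' -> tys s G L b -> tys s G' L b.
Proof.
case: L => [|M L] p.
  move/tys_nilE=> [-> E ->]; rewrite E perm_sym in p.
  by rewrite (perm_nilP p); constructor.
move/tys_consE=> [s1 [s2 [G1 [G2 [c [d [T1 T2 p1 -> ->]]]]]]].
by apply: (tys_cons T1 T2) => //; perm_solve.
Qed.

Lemma ty_perm s G G' M a : perm_eq G G' -> ty s G M a -> ty s G' M a.
Proof.
elim/term_nested_ind: M s G G' a => [x|M IH|M L N _ _ _|L _] s G G' a pG T.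
- by move/ty_varE: T => [-> p]; constructor; perm_solve.
- inversion T as [|? ? ? b a0 ? T' E| |]; subst.
  apply: (@ty_lam _ _ _ b a0) => //; apply: IH T'.
  by rewrite perm_cat2l; exact: perm_map.
- inversion T as [| |? s1 s2 ? G1 G2 ? ? ? K b ? T1 KN T2 p E|]; subst.
  by apply: (ty_app T1 KN T2) => //; perm_solve.
- inversion T as [| | |? ? ? ? T1]; subst.
  by constructor=> //; apply: tys_perm_env T1.
Qed.

(** By injectivity of [dcons], the list stored in the abstraction rule is determined up to
    permutation, and [ty_perm] moves the derivation of the body to the prescribed representative. *)
Lemma ty_lamE s G M b a : ty s G (Lam M) (dcons (seq_mset b) a) <->
  exists2 s', s = s'.+1 & ty s' (assign 0 b ++ ren S G) M a.
Proof.
split=> [T|[s' -> T]]; last exact: ty_lam T erefl.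
inversion T as [|s' ? ? b' a' ? T' E| |]; subst.
have [p ->] := dcons_seq_inj E; exists s' => //; apply: ty_perm T'.
by rewrite perm_cat2r perm_map // perm_sym.
Qed.

Lemma tys_size s G L b : tys s G L b -> size b = size L.
Proof.
elim: L s G b => [|M L IH] s G b; first by move/tys_nilE=> [_ _ ->].
move/tys_consE=> [s1 [s2 [G1 [G2 [a [c [_ /IH Ec _ _ ->]]]]]]] /=.
by rewrite Ec.
Qed.

Lemma tys_cat s1 s2 G1 G2 L1 L2 b1 b2 :
  tys s1 G1 L1 b1 -> tys s2 G2 L2 b2 ->
  tys (s1 + s2) (G1 ++ G2) (L1 ++ L2) (b1 ++ b2).
Proof.
elim: L1 s1 G1 b1 => [|M L IH] s G b T T2; first by case/tys_nilE: T => -> -> ->.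
case/tys_consE: T => [t1 [t2 [H1 [H2 [a [c [T1 T3 p -> ->]]]]]]].
apply: (tys_cons T1 (IH _ _ _ T3 T2)); last lia.
perm_solve.
Qed.

Lemma tys_catE s G L1 L2 b : tys s G (L1 ++ L2) b ->
  exists s1 s2 G1 G2 b1 b2, [/\ tys s1 G1 L1 b1, tys s2 G2 L2 b2,
    perm_eq G (G1 ++ G2), s = s1 + s2 & b = b1 ++ b2].
Proof.
elim: L1 s G b => [|M L IH] s G b /=.
  by move=> T; exists 0, s, [::], G, [::], b; split=> //; constructor.
move/tys_consE=> [t1 [t2 [H1 [H2 [a [c [T1 T3 p -> ->]]]]]]].
have [s1 [s2 [G1 [G2 [b1 [b2 [T4 T5 p' -> ->]]]]]]] := IH _ _ _ T3.
exists (t1 + s1), s2, (H1 ++ G1), G2, (a :: b1), b2; split=> //; try lia.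
- exact: tys_cons T1 T4 (perm_refl _) erefl.
- perm_solve.
Qed.

Lemma cat_inj T (s1 s2 t1 t2 : seq T) :
  size s1 = size t1 -> s1 ++ s2 = t1 ++ t2 -> s1 = t1 /\ s2 = t2.
Proof. by elim: s1 t1 => [|x s1 IH] [|y t1] //= [/IH H] [-> /H[-> ->]]. Qed.

Lemma tys_cat_bE s G L b1 b2 : tys s G L (b1 ++ b2) ->
  exists s1 s2 G1 G2 L1 L2, [/\ tys s1 G1 L1 b1, tys s2 G2 L2 b2,
    perm_eq G (G1 ++ G2), s = s1 + s2 & L = L1 ++ L2].
Proof.
move=> T; have sz := tys_size T.
rewrite -(cat_take_drop (size b1) L) in T.
have [s1 [s2 [G1 [G2 [c1 [c2 [T1 T2 p -> E]]]]]]] := tys_catE T.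
have sz1 := tys_size T1.
have szE : size b1 = size c1.
  by rewrite sz1 size_takel // -sz size_cat leq_addr.
have [E1 E2] := cat_inj szE E.
rewrite -E1 in T1; rewrite -E2 in T2.
exists s1, s2, G1, G2, (take (size b1) L), (drop (size b1) L).
by split=> //; rewrite cat_take_drop.
Qed.

(** The head of [b'] is located in [b] and its term is moved to the front. This serves to share out
    derivations of arguments along a partition of their types. *)
Lemma tys_perm_types s G L b b' : perm_eq b b' -> tys s G L b ->
  exists2 L', Permutation.Permutation L L' & tys s G L' b'.
Proof.
elim: b' b s G L => [|a b' IH] b s G L p T.
  by move/perm_nilP: p T => ->; exists L => //; exact: Permutation.Permutation_refl.
have /splitPr ab : a \in b by rewrite (perm_mem p) mem_head.
case: b / ab p T => b1 b2 p T.
have [s1 [s2 [G1 [G2 [L1 [L2 [T1 T2 pG E EL]]]]]]] := tys_cat_bE T.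
case: L2 T2 EL => [/tys_nilE[]//|M L2] /tys_consE[t1 [t2 [H1 [H2 [a0 [c0 [T3 T4 pG' Es [Ea Eb]]]]]]]] EL.
subst a0 c0.
have p' : perm_eq (b1 ++ b2) b' by perm_solve.
have [L' pL T'] := IH _ _ _ _ p' (tys_cat T1 T4).
exists (M :: L').
  subst L; apply: Permutation.Permutation_trans (Permutation.perm_skip M pL).
  by apply: Permutation.Permutation_sym; exact: Permutation.Permutation_middle.
by apply: (tys_cons T3 T') => //; [perm_solve | lia].
Qed.

Lemma tys_perm_terms s G L L' b : Permutation.Permutation L L' -> tys s G L b ->
  exists2 b', perm_eq b b' & tys s G L' b'.
Proof.
move=> P; elim: P s G b => [|M L1 L2 _ IH|M1 M2 L1|L1 L2 L3 _ IH1 _ IH2] s G b T.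
- by exists b.
- move/tys_consE: T => [s1 [s2 [G1 [G2 [a [c [T1 T2 p -> ->]]]]]]].
  have [b' pb T'] := IH _ _ _ T2.
  by exists (a :: b'); [rewrite perm_cons | exact: tys_cons T1 T' p erefl].
- move/tys_consE: T => [s1 [s2 [G1 [G2 [a [c [T1 /tys_consE T2 p -> ->]]]]]]].
  move: T2 => [s3 [s4 [G3 [G4 [a' [c' [T3 T4 p' -> ->]]]]]]].
  exists [:: a', a & c']; first by rewrite -![_ :: _ :: c']/([:: _; _] ++ c') perm_cat2r; perm_solve.
  apply: (tys_cons T3 (tys_cons T1 T4 (perm_refl _) erefl)); last lia.
  perm_solve.
- have [b1 p1 T1] := IH1 _ _ _ T; have [b2 p2 T2] := IH2 _ _ _ T1.
  by exists b2 => //; perm_solve.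
Qed.

Lemma ty_appE s G M P a : ty s G (App M P) a <->
  exists s1 s2 G1 G2 b, [/\ ty s1 G1 M (dcons (seq_mset b) a),
    tybag s2 G2 P b, perm_eq G (G1 ++ G2) & s = (s1 + s2).+1].
Proof.
case: P => L N; split=> [T|[s1 [s2 [G1 [G2 [b [T1 [K [b' [KN pb T2]]] pG Es]]]]]]].
  inversion T as [| |? s1 s2 ? G1 G2 ? ? ? K b ? T1 KN T2 p E|]; subst.
  by exists s1, s2, G1, G2, b; split=> //; exists K, b.
by rewrite (seq_mset_perm pb) in T1; exact: ty_app T1 KN T2 pG Es.
Qed.

Lemma ty_taubarE s G V a : ty s G (TauBar V) a <->
  exists s', [/\ s = s'.+1, tytest s' G V & a = star].
Proof.
case: V => L; split=> [T|[s' [-> T ->]]]; last by constructor.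
by inversion T as [| | |s' ? ? ? T1]; exists s'.
Qed.

(** * Environments and renaming *)

Lemma ren_cat f G G' : ren f (G ++ G') = ren f G ++ ren f G'.
Proof. exact: map_cat. Qed.

Lemma ren_assign f x b : ren f (assign x b) = assign (f x) b.
Proof. by rewrite /ren /assign -map_comp. Qed.

Lemma ren_upren f G : ren (upren f) (ren S G) = ren S (ren f G).
Proof. by rewrite /ren -!map_comp. Qed.

Lemma absent_cat x G G' : absent x (G ++ G') = absent x G && absent x G'.
Proof. by rewrite /absent map_cat mem_cat negb_or. Qed.

Lemma absent_assign x y b : x != y -> absent x (assign y b).
Proof.
by move=> nxy; rewrite /absent /assign -map_comp; apply/mapP=> -[z _ /= E]; rewrite E eqxx in nxy.
Qed.

Lemma absent0_renS G : absent 0 (ren S G).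
Proof. by rewrite /absent /ren -map_comp; apply/mapP=> -[]. Qed.

Lemma absentS_renS x G : absent x.+1 (ren S G) = absent x G.
Proof. by rewrite /absent /ren -map_comp (map_comp S) mem_map //; exact: succn_inj. Qed.

Lemma absent_perm x G G' : perm_eq G G' -> absent x G = absent x G'.
Proof. by move=> p; rewrite /absent (perm_mem (perm_map _ p)). Qed.

Lemma absent0E G : absent 0 G -> G = ren S (ren predn G).
Proof.
rewrite /absent /ren => a0; rewrite -map_comp -[LHS]map_id; apply/eq_in_map => -[[|x] d] xG //.
by case/negP: a0; apply/mapP; exists (0, d).
Qed.

Lemma env_split x G : exists b G', perm_eq G (assign x b ++ G') /\ absent x G'.
Proof.
exists [seq p.2 | p <- G & p.1 == x], [seq p <- G | p.1 != x]; split; last first.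
  by apply/mapP => -[p]; rewrite mem_filter => /andP[/eqP np _] E; case: np.
have -> : assign x [seq p.2 | p <- G & p.1 == x] = [seq p <- G | p.1 == x].
  rewrite /assign -map_comp -[RHS]map_id; apply/eq_in_map => -[y d].
  by rewrite mem_filter /= => /andP[/eqP->].
by rewrite perm_sym perm_filterC.
Qed.

Lemma env_split0 G : exists b G', perm_eq G (assign 0 b ++ ren S G').
Proof.
have [b [G' [p /absent0E E]]] := env_split 0 G.
by exists b, (ren predn G'); rewrite -E.
Qed.

Lemma filter_absent x G :
  absent x G -> [seq p <- G | p.1 == x] = [::] /\ [seq p <- G | p.1 != x] = G.
Proof.
move=> aG; have H p : p \in G -> p.1 != x.
  by move=> pG; apply: contra aG => /eqP <-; exact: map_f.
split; last by apply/all_filterP/allP.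
by apply/eqP; rewrite -size_eq0 size_filter -leqn0 leqNgt -has_count; apply/hasPn.
Qed.

Lemma filter_assign x b :
  [seq p <- assign x b | p.1 == x] = assign x b /\ [seq p <- assign x b | p.1 != x] = [::].
Proof. by elim: b => //= a b [E1 E2]; rewrite eqxx /= E1 E2. Qed.

(** Filtering by [p.1 == x] and by its negation separates the two parts. Every inversion under a
    binder rests on this: it recovers the types of the bound variable from a permutation of
    environments. *)
Lemma split_uniq x b b' G G' : absent x G -> absent x G' ->
  perm_eq (assign x b ++ G) (assign x b' ++ G') -> perm_eq b b' /\ perm_eq G G'.
Proof.
move=> /filter_absent[a1 a2] /filter_absent[a3 a4] p.
have [t1 t2] := filter_assign x b; have [t3 t4] := filter_assign x b'.
split.
- have := perm_filter (fun p => p.1 == x) p.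
  rewrite !filter_cat a1 a3 t1 t3 !cats0 => /(perm_map snd).
  by rewrite /assign -!map_comp !map_id.
- by have := perm_filter (fun p => p.1 != x) p; rewrite !filter_cat a2 a4 t2 t4.
Qed.

Lemma assign_perm x b b' : perm_eq b b' -> perm_eq (assign x b) (assign x b').
Proof. exact: perm_map. Qed.

Lemma ren_perm f G G' : perm_eq G G' -> perm_eq (ren f G) (ren f G').
Proof. exact: perm_map. Qed.

Lemma ren_perm_inj f G G' :
  injective f -> perm_eq (ren f G) (ren f G') -> perm_eq G G'.
Proof. by move=> fI; apply: perm_map_inj => -[x a] [y b] [/fI-> ->]. Qed.

Lemma split0_uniq b b' G G' : perm_eq (assign 0 b ++ ren S G) (assign 0 b' ++ ren S G') ->
  perm_eq b b' /\ perm_eq G G'.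
Proof.
move/split_uniq => /(_ (absent0_renS _) (absent0_renS _))[pb pG]; split=> //.
exact: ren_perm_inj succn_inj pG.
Qed.

(** The uses of [x] are shared out between the two premises of a rule. *)
Lemma split_cat x b G' G1 G2 : absent x G' -> perm_eq (assign x b ++ G') (G1 ++ G2) ->
  exists b1 b2 G1' G2', [/\ perm_eq G1 (assign x b1 ++ G1'), perm_eq G2 (assign x b2 ++ G2'),
    perm_eq b (b1 ++ b2), perm_eq G' (G1' ++ G2') & absent x G1' /\ absent x G2'].
Proof.
move=> aG p; have [b1 [G1' [p1 a1]]] := env_split x G1.
have [b2 [G2' [p2 a2]]] := env_split x G2.
have : perm_eq (assign x b ++ G') (assign x (b1 ++ b2) ++ (G1' ++ G2')) by perm_solve.
move/split_uniq; rewrite absent_cat a1 a2 => /(_ aG isT)[pb pG].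
by exists b1, b2, G1', G2'.
Qed.

Lemma perm_cons_cat (T : eqType) (p : T) (G G1 G2 : seq T) :
  perm_eq (p :: G) (G1 ++ G2) ->
  (exists2 G1', perm_eq G1 (p :: G1') & perm_eq G (G1' ++ G2)) \/
  (exists2 G2', perm_eq G2 (p :: G2') & perm_eq G (G1 ++ G2')).
Proof.
move=> pG; have : p \in G1 ++ G2 by rewrite -(perm_mem pG) mem_head.
rewrite mem_cat => /orP[] /perm_to_rem pr; [left|right].
  by exists (rem p G1) => //; perm_solve.
by exists (rem p G2) => //; perm_solve.
Qed.


(** The lemmas named [_of] lift to lists a property assumed for the members only, which is the form
    that the induction hypotheses of [term_nested_ind] have. *)
Lemma tys_ren_of f L :
  (forall M, List.In M L -> forall s G a, ty s G M a -> ty s (ren f G) (rename f M) a) ->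
  forall s G b, tys s G L b -> tys s (ren f G) (map (rename f) L) b.
Proof.
elim: L => [|M L IH] HL s G b; first by move/tys_nilE=> [-> -> ->]; constructor.
move/tys_consE=> [s1 [s2 [G1 [G2 [a' [c [T1 T2 p -> ->]]]]]]].
apply: (tys_cons (HL _ (or_introl erefl) _ _ _ T1) (IH _ _ _ _ T2)) => //.
  by move=> M1 M1L; apply: HL; right.
by rewrite -ren_cat; exact: ren_perm.
Qed.

(** This covers renamings that identify variables, such as [predn]: the types of the identified
    variables are then collected under one name. *)
Lemma ty_ren f M s G a : ty s G M a -> ty s (ren f G) (rename f M) a.
Proof.
elim/term_nested_ind: M f s G a => [x|M IH|M L N IHM IHL IHN|L IHL] f s G a.
- by move/ty_varE=> [-> /(ren_perm f) p]; constructor.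
- have [b [a' ->]] := dcons_seqE a.
  move/ty_lamE=> [s' -> /(IH (upren f)) T]; apply/ty_lamE; exists s' => //.
  by rewrite ren_cat ren_assign ren_upren in T.
- move/ty_appE=> [s1 [s2 [G1 [G2 [b [T1 [K [b' [KN pb T2]]] pG Es]]]]]].
  apply/ty_appE; exists s1, s2, (ren f G1), (ren f G2), b; split=> //; first exact: IHM.
    exists (map (rename f) K), b'; split=> //.
      by move=> k /In_map[k' k'K ->]; apply/In_map; exists k' => //; exact: KN.
    rewrite -map_cat; apply: tys_ren_of T2 => A /In_cat[/IHL|/KN/IHN] H *; exact: H.
  by rewrite -ren_cat; exact: ren_perm.
- move/ty_taubarE=> [s' [-> T ->]]; apply/ty_taubarE; exists s'; split=> //=.
  by rewrite size_map; apply: tys_ren_of T => A /IHL H *; exact: H.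
Qed.

Lemma tys_ren f s G L b : tys s G L b -> tys s (ren f G) (map (rename f) L) b.
Proof. by apply: tys_ren_of => *; exact: ty_ren. Qed.

Lemma tys_ren_inv_of f L :
  (forall M, List.In M L -> forall s G a, ty s G (rename f M) a ->
     exists2 G0, perm_eq G (ren f G0) & ty s G0 M a) ->
  forall s G b, tys s G (map (rename f) L) b ->
  exists2 G0, perm_eq G (ren f G0) & tys s G0 L b.
Proof.
elim: L => [|M L IH] HL s G b /=.
  by move/tys_nilE=> [-> -> ->]; exists [::] => //; constructor.
move/tys_consE=> [s1 [s2 [G1 [G2 [a' [c [T1 T2 p -> ->]]]]]]].
have [H1 p1 T1'] := HL _ (or_introl erefl) _ _ _ T1.
have [|H2 p2 T2'] := IH _ _ _ _ T2; first by move=> M1 M1L; apply: HL; right.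
exists (H1 ++ H2); first by rewrite ren_cat; perm_solve.
exact: tys_cons T1' T2' (perm_refl _) erefl.
Qed.

Lemma incl_map T U (f : T -> U) K N : List.incl K (map f N) ->
  exists2 K', List.incl K' N & K = map f K'.
Proof.
elim: K => [|k K IH] KN; first by exists [::].
have [|K' K'N ->] := IH; first by move=> x xK; apply: KN; right.
have /In_map[k' k'N ->] := KN k (or_introl erefl).
by exists (k' :: K') => // x [<-|/K'N].
Qed.

Lemma ty_ren_inv f M s G a : ty s G (rename f M) a ->
  exists2 G0, perm_eq G (ren f G0) & ty s G0 M a.
Proof.
elim/term_nested_ind: M f s G a => [x|M IH|M L N IHM IHL IHN|L IHL] f s G a /=.
- by move/ty_varE=> [-> p]; exists [:: (x, a)] => //; constructor.
- have [b [a' ->]] := dcons_seqE a.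
  move/ty_lamE=> [s' -> /IH[G0 p T]].
  (* Only 0 is sent to 0 by [upren f], so both environments can be split at 0 and compared. *)
  have [c [G1 p1]] := env_split0 G0.
  have := ren_perm (upren f) p1; rewrite ren_cat ren_assign ren_upren => p2.
  have [pb pG] := split0_uniq (perm_trans p p2).
  exists G1 => //; apply/ty_lamE; exists s' => //.
  apply: ty_perm T; apply: (perm_trans p1); rewrite perm_cat2r.
  by rewrite perm_sym; exact: perm_map.
- move/ty_appE=> [s1 [s2 [G1 [G2 [b [T1 [K [b' [KN pb T2]]] pG Es]]]]]].
  have [K' K'N EK] := incl_map KN; rewrite EK -map_cat in T2.
  have [H1 p1 T1'] := IHM _ _ _ _ T1.
  have [|H2 p2 T2'] := tys_ren_inv_of _ T2.
    by move=> A /In_cat[/IHL|/K'N/IHN] H *; exact: H.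
  exists (H1 ++ H2); first by rewrite ren_cat; perm_solve.
  apply/ty_appE; exists s1, s2, H1, H2, b; split=> //.
  by exists K', b'.
- move/ty_taubarE=> [s' [-> /= T ->]]; rewrite size_map in T.
  have [|H p T'] := tys_ren_inv_of _ T; first by move=> A /IHL H *; exact: H.
  by exists H => //; apply/ty_taubarE; exists s'.
Qed.

Lemma tys_ren_inv f s G L b : tys s G (map (rename f) L) b ->
  exists2 G0, perm_eq G (ren f G0) & tys s G0 L b.
Proof. by apply: tys_ren_inv_of => *; exact: ty_ren_inv. Qed.

(** * Substitution *)

Lemma tys_lsubst_of x A L :
  (forall M, List.In M L -> forall s G a d G' t H,
     ty s G M a -> perm_eq G ((x, d) :: G') -> ty t H A d ->
     exists2 M', List.In M' (lsubst x A M) & ty (s + t) (G' ++ H) M' a) ->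
  forall s G b d G' t H,
    tys s G L b -> perm_eq G ((x, d) :: G') -> ty t H A d ->
  exists L1 M L2 M', [/\ L = L1 ++ M :: L2, List.In M' (lsubst x A M)
    & tys (s + t) (G' ++ H) (L1 ++ M' :: L2) b].
Proof.
elim: L => [|M L IH] HL s G b d G' t H.
  by move=> /tys_nilE[_ -> _]; rewrite perm_sym => /perm_nilP.
move/tys_consE=> [s1 [s2 [G1 [G2 [a' [c [T1 T2 p -> ->]]]]]]] pG TA.
rewrite perm_sym in pG.
case: (perm_cons_cat (perm_trans pG p)) => -[G3 p3 p4].
  have [M' M'M T] := HL _ (or_introl erefl) _ _ _ _ _ _ _ T1 p3 TA.
  exists [::], M, L, M'; split=> //=.
  apply: (tys_cons T T2); [perm_solve | lia].
have [|L1 [M0 [L2 [M' [-> M'M T]]]]] := IH _ _ _ _ _ _ _ _ T2 p3 TA.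
  by move=> M1 M1L; apply: HL; right.
exists (M :: L1), M0, L2, M'; split=> //=.
apply: (tys_cons T1 T); [perm_solve | lia].
Qed.

(** Applied to the linear components [L] and the promoted copies [K] of a bag, this decides in which
    of them the substituted occurrence lies. *)
Lemma cat_eq_mid T (L K : seq T) L1 M L2 : L ++ K = L1 ++ M :: L2 ->
  (exists2 L3, L = L1 ++ M :: L3 & L2 = L3 ++ K) \/
  (exists2 K1, K = K1 ++ M :: L2 & L1 = L ++ K1).
Proof.
elim: L L1 => [|A L IH] [|B L1] //=.
- by move=> ->; right; exists [::].
- by move=> ->; right; exists (B :: L1).
- by move=> [-> <-]; left; exists L.
- by move=> [-> /IH[[L3 -> ->]|[K1 -> ->]]]; [left; exists L3 | right; exists K1].
Qed.

Lemma perm_single (T : eqType) (p q : T) G :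
  perm_eq [:: p] (q :: G) -> p = q /\ G = [::].
Proof. by rewrite perm_sym => /(perm_small_eq (isT : size [:: p] <= 1))[-> ->]. Qed.

(** The use [(x, d)] is followed to the single variable rule that consumes it, where the derivation
    of [A] is grafted. That rule has size 0, so the sizes add exactly. *)
Lemma ty_lsubst x A M s G a d G' t H :
  ty s G M a -> perm_eq G ((x, d) :: G') -> ty t H A d ->
  exists2 M', List.In M' (lsubst x A M) & ty (s + t) (G' ++ H) M' a.
Proof.
elim/term_nested_ind: M x A s G a d G' t H
    => [y|M IH|M L N IHM IHL IHN|L IHL] x A s G a d G' t H /=.
- move/ty_varE=> [-> p] pG TA; rewrite perm_sym in p.
  have [[-> ->] ->] := perm_single (perm_trans p pG).
  rewrite eqxx; exists A; first by left.
  exact: TA.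
- have [b [a' ->]] := dcons_seqE a.
  move/ty_lamE=> [s' -> T] pG /(ty_ren S) TA.
  have pG' : perm_eq (assign 0 b ++ ren S G)
               ((x.+1, d) :: assign 0 b ++ ren S G').
    have := ren_perm S pG => {pG} /= pG; perm_solve.
  have [M' M'M T'] := IH _ _ _ _ _ _ _ _ _ T pG' TA.
  exists (Lam M'); first by apply/In_map; exists M'.
  by apply/ty_lamE; exists (s' + t) => //; rewrite ren_cat catA.
- move/ty_appE=> [s1 [s2 [G1 [G2 [b [T1 [K [b' [KN pb T2]]] p Es]]]]]] pG TA.
  rewrite perm_sym in pG.
  case: (perm_cons_cat (perm_trans pG p)) => -[G3 p3 p4].
    have [M' M'M T] := IHM _ _ _ _ _ _ _ _ _ T1 p3 TA.
    exists (App M' (Bag L N)); first by apply/In_cat; left; apply/In_map; exists M'.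
    apply/ty_appE; exists (s1 + t), s2, (G3 ++ H), G2, b; split=> //; last by lia.
      by exists K, b'.
    perm_solve.
  have [|L1 [M0 [L2 [M' [E M'M T]]]]] := tys_lsubst_of _ T2 p3 TA.
    by move=> B /In_cat[/IHL|/KN/IHN] HB; exact: HB.
  have fin P : List.In P (lsubst_bag x A (Bag L N)) ->
      tybag (s2 + t) (G3 ++ H) P b ->
      exists2 M', List.In M' (lsubst x A (App M (Bag L N))) & ty (s + t) (G' ++ H) M' a.
    move=> PL TP; exists (App M P); first by apply/In_cat; right; apply/In_map; exists P.
    apply/ty_appE; exists s1, (s2 + t), G1, (G3 ++ H), b; split=> //; last by lia.
    perm_solve.
  case: (cat_eq_mid E) => -[L3 E1 E2].
    apply: (fin (Bag (L1 ++ M' :: L3) N)).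
      apply/In_cat; left; apply/In_map; exists (L1 ++ M' :: L3) => //.
      by apply/In_derive_seq; exists L1, M0, L3, M'.
    by exists K, b'; split=> //; rewrite -catA /= -E2.
  (* The occurrence lies in a promoted copy: that copy becomes linear, and [L3 ++ L2] is what
     remains of [K] without it. *)
  apply: (fin (Bag (M' :: L) N)).
    apply/In_cat; right; apply/In_map; exists M' => //.
    apply/In_flatten; exists (lsubst x A M0) => //; apply/In_map; exists M0 => //.
    by apply: KN; rewrite E1; apply/In_cat; right; left.
  have P : Permutation.Permutation (L1 ++ M' :: L2) ((M' :: L) ++ (L3 ++ L2)).
    rewrite E2 -catA catA; apply: Permutation.Permutation_sym.
    by rewrite catA; exact: Permutation.Permutation_middle.
  have [c pc Tc] := tys_perm_terms P T.
  exists (L3 ++ L2), c; split=> //; last by perm_solve.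
  move=> B /In_cat BL; apply: KN; rewrite E1; apply/In_cat.
  by case: BL; [left | right; right].
- move/ty_taubarE=> [s' [-> /= T ->]] pG TA.
  have [|L1 [M0 [L2 [M' [E M'M T']]]]] := tys_lsubst_of _ T pG TA.
    by move=> B /IHL HB; exact: HB.
  exists (TauBar (Tau (L1 ++ M' :: L2))).
    apply/In_map; exists (Tau (L1 ++ M' :: L2)) => //; apply/In_map.
    by exists (L1 ++ M' :: L2) => //; apply/In_derive_seq; exists L1, M0, L2, M'.
  apply/ty_taubarE; exists (s' + t); split=> //=.
  by have -> : size (L1 ++ M' :: L2) = size L by rewrite E !size_cat.
Qed.

Lemma tys_lsubst_inv_of x A M M' L1 L2 :
  (forall s G a, ty s G M' a -> exists s1 s2 G1 G2 d,
     [/\ perm_eq G (G1 ++ G2), ty s1 ((x, d) :: G1) M a & ty s2 G2 A d]) ->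
  forall s G b, tys s G (L1 ++ M' :: L2) b -> exists s1 s2 G1 G2 d,
    [/\ perm_eq G (G1 ++ G2), tys s1 ((x, d) :: G1) (L1 ++ M :: L2) b & ty s2 G2 A d].
Proof.
move=> HM s G b.
move=> /tys_catE[t1 [t2 [H1 [H2 [b1 [b2 [T1 /tys_consE T2 p _ ->]]]]]]].
move: T2 => [t3 [t4 [H3 [H4 [a [c [/HM T3 T4 p' _ ->]]]]]]].
move: T3 => [s1 [s2 [G1 [G2 [d [p3 T3 TA]]]]]].
exists (t1 + (s1 + t4)), s2, (H1 ++ G1 ++ H4), G2, d; split=> //.
  by perm_solve.
have T := tys_cat T1 (tys_cons T3 T4 (perm_refl _) erefl).
apply: tys_perm_env T; perm_solve.
Qed.

(** The summand [M'] contains one inserted copy of [A], in a linear position; the type at which the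
    derivation uses that copy is the type [d] at which [M] uses [x]. *)
Lemma ty_lsubst_inv x A M M' s G a :
  List.In M' (lsubst x A M) -> ty s G M' a -> exists s1 s2 G1 G2 d,
    [/\ perm_eq G (G1 ++ G2), ty s1 ((x, d) :: G1) M a & ty s2 G2 A d].
Proof.
elim/term_nested_ind: M x A M' s G a
    => [y|M IH|M L N IHM IHL IHN|L IHL] x A M' s G a /=.
- case: eqP => [->|//] [<-|//] T; exists 0, s, [::], G, a; split=> //.
  by constructor.
- move/In_map=> [M0 M0M ->]; have [b [a' ->]] := dcons_seqE a.
  move/ty_lamE=> [s' _ T]; have [s1 [s2 [G1 [G2 [d [p T1 T2]]]]]] := IH _ _ _ _ _ _ M0M T.
  have [H2 p2 TA] := ty_ren_inv T2.
  (* The shifted [A] uses no variable 0, so all types of the bound variable lie in [G1]. *)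
  have [b1 [H1 p1]] := env_split0 G1.
  have : perm_eq (assign 0 b ++ ren S G) (assign 0 b1 ++ ren S (H1 ++ H2)).
    by rewrite ren_cat; perm_solve.
  case/split0_uniq=> pb pG; exists s1.+1, s2, H1, H2, d; split=> //.
  apply/ty_lamE; exists s1 => //; apply: ty_perm T1.
  have {}pb := assign_perm 0 pb.
  rewrite /=; perm_solve.
- case/In_cat=> /In_map[].
    move=> M0 M0M -> /ty_appE[t1 [t2 [H1 [H2 [b [T1 T2 p _]]]]]].
    have [s1 [s2 [G1 [G2 [d [p' T1' TA]]]]]] := IHM _ _ _ _ _ _ M0M T1.
    exists (s1 + t2).+1, s2, (G1 ++ H2), G2, d; split=> //; first by perm_solve.
    by apply/ty_appE; exists s1, t2, ((x, d) :: G1), H2, b.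
  move=> P PL -> /ty_appE[t1 [t2 [H1 [H2 [b [T1 T2 p _]]]]]].
  have {}fin s1 s2 G1 G2 d : perm_eq H2 (G1 ++ G2) ->
      tybag s1 ((x, d) :: G1) (Bag L N) b -> ty s2 G2 A d ->
      exists s1 s2 G1 G2 d, [/\ perm_eq G (G1 ++ G2),
        ty s1 ((x, d) :: G1) (App M (Bag L N)) a & ty s2 G2 A d].
    move=> p2 TB TA; exists (t1 + s1).+1, s2, (H1 ++ G1), G2, d; split=> //.
      by perm_solve.
    apply/ty_appE; exists t1, s1, H1, ((x, d) :: G1), b; split=> //; perm_solve.
  case/In_cat: PL T2 => /In_map[].
    move=> L' /In_derive_seq[L1 [M0 [L2 [M1 [EL M1M ->]]]]] -> [K [b' [KN pb]]].
    rewrite -catA /= => TL.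
    have [|s1 [s2 [G1 [G2 [d [p' T' TA]]]]]] := tys_lsubst_inv_of (x := x) (A := A) (M := M0) _ TL.
      have M0L : List.In M0 L by rewrite EL; apply/In_cat; right; left.
      by move=> s0 G0 a0; exact: (IHL M0 M0L x A M1 s0 G0 a0 M1M).
    by apply: (fin s1 s2 G1 G2 d) => //; exists K, b'; split=> //; rewrite EL -catA.
  move=> k' /In_flatten[_ /In_map[k kN ->] k'k] -> [K [b' [KN pb TL]]].
  have [|s1 [s2 [G1 [G2 [d [p' T' TA]]]]]] :=
      @tys_lsubst_inv_of x A k k' [::] (L ++ K) _ _ _ _ TL.
    by move=> s0 G0 a0; exact: (IHN k kN x A k' s0 G0 a0 k'k).
  (* The linear copy extracted by the substitution is put back among the promoted ones. *)
  have [c pc Tc] := tys_perm_terms (Permutation.Permutation_middle L K k) T'.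
  apply: (fin s1 s2 G1 G2 d) => //; exists (k :: K), c; split=> //; last by perm_solve.
  by move=> B [<-|/KN].
- move/In_map=> [V /In_map[L' /In_derive_seq[L1 [M0 [L2 [M1 [EL M1M ->]]]]] ->] ->].
  move/ty_taubarE=> [s' [_ /= T ->]].
  have [|s1 [s2 [G1 [G2 [d [p' T' TA]]]]]] := tys_lsubst_inv_of (x := x) (A := A) (M := M0) _ T.
    have M0L : List.In M0 L by rewrite EL; apply/In_cat; right; left.
    by move=> s0 G0 a0; exact: (IHL M0 M0L x A M1 s0 G0 a0 M1M).
  exists s1.+1, s2, G1, G2, d; split=> //; apply/ty_taubarE; exists s1; split=> //=.
  by move: T'; rewrite EL !size_cat /=.
Qed.

Lemma tys_split t H K b b1 b2 : perm_eq b (b1 ++ b2) -> tys t H K b ->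
  exists t1 t2 H1 H2 K1 K2, [/\ tys t1 H1 K1 b1, tys t2 H2 K2 b2,
    perm_eq H (H1 ++ H2), t = t1 + t2 & List.incl K1 K /\ List.incl K2 K].
Proof.
move=> p /(tys_perm_types p)[K' pK].
move=> /tys_cat_bE[t1 [t2 [H1 [H2 [K1 [K2 [T1 T2 pH -> E]]]]]]].
have sub : List.incl K' K.
  by move=> A; apply: Permutation.Permutation_in; exact: Permutation.Permutation_sym.
exists t1, t2, H1, H2, K1, K2; split=> //.
by split=> A KA; apply: sub; rewrite E; apply/In_cat; [left|right].
Qed.

Lemma tys_subst_of x Ns L :
  (forall M, List.In M L -> forall s G a b G' t H K,
     ty s G M a -> perm_eq G (assign x b ++ G') -> absent x G' ->
     List.incl K Ns -> tys t H K b ->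
     exists2 M', List.In M' (subst x Ns M) & ty (s + t) (G' ++ H) M' a) ->
  forall s G c b G' t H K,
    tys s G L c -> perm_eq G (assign x b ++ G') -> absent x G' ->
    List.incl K Ns -> tys t H K b ->
  exists2 L', List.Forall2 (fun M M' => List.In M' (subst x Ns M)) L L'
    & tys (s + t) (G' ++ H) L' c.
Proof.
elim: L => [|M L IH] HL s G c b G' t H K.
  move=> /tys_nilE[-> -> ->]; rewrite perm_sym => /perm_nilP.
  case: b G' => [|//] [|//] _ _ _ TK; have /esym/size0nil EK := tys_size TK.
  move: TK; rewrite EK => /tys_nilE[-> -> _].
  by exists [::]; constructor.
move/tys_consE=> [s1 [s2 [G1 [G2 [a' [c' [T1 T2 p -> ->]]]]]]] pG aG KS TK.
rewrite perm_sym in pG.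
have [b1 [b2 [G3 [G4 [p1 p2 pb pG' [a1 a2]]]]]] := split_cat aG (perm_trans pG p).
have [t1 [t2 [H1 [H2 [K1 [K2 [TK1 TK2 pH -> [KK1 KK2]]]]]]]] := tys_split pb TK.
have [M' M'M T] := HL _ (or_introl erefl) _ _ _ _ _ _ _ _ T1 p1 a1
  (List.incl_tran KK1 KS) TK1.
have [|L' L'L T'] := IH _ _ _ _ _ _ _ _ _ T2 p2 a2 (List.incl_tran KK2 KS) TK2.
  by move=> M1 M1L; apply: HL; right.
exists (M' :: L'); first by constructor.
apply: (tys_cons T T'); [clear -pG' pH; perm_solve | lia].
Qed.

Lemma Forall2_in_r T U (R : T -> U -> Prop) s t y :
  List.Forall2 R s t -> List.In y t -> exists2 x, List.In x s & R x y.
Proof.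
elim=> // x z s' t' Rxz _ IH [<-|/IH[w ws Rw]]; first by exists x; [left|].
by exists w; [right|].
Qed.

Lemma Forall2_length T U (R : T -> U -> Prop) s t :
  List.Forall2 R s t -> size s = size t.
Proof. by elim=> //= x z s' t' _ _ ->. Qed.

(** Since [G'] does not mention [x], the list [b] holds all its uses, and [K] supplies one element
    of [Ns] for each. These elements dictate which summand of the result is typed. *)
Lemma ty_subst x Ns M s G a b G' t H K :
  ty s G M a -> perm_eq G (assign x b ++ G') -> absent x G' ->
  List.incl K Ns -> tys t H K b ->
  exists2 M', List.In M' (subst x Ns M) & ty (s + t) (G' ++ H) M' a.
Proof.
elim/term_nested_ind: M x Ns s G a b G' t H K
    => [y|M IH|M L N IHM IHL IHN|L IHL] x Ns s G a b G' t H K /=.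
- move/ty_varE=> [-> p] pG aG KS TK; rewrite perm_sym in p.
  (* Either [b] is empty and [y] differs from [x], or [b] is the singleton of [a], [y] is [x] and
     [K] is a single copy. *)
  have {p pG} := perm_trans p pG; case: b TK => [|d b] TK.
    have /esym/size0nil EK := tys_size TK; move: TK; rewrite EK => /tys_nilE[-> -> _] p.
    have ny : y != x by move: aG; rewrite -(absent_perm x p) /absent inE eq_sym.
    rewrite (negbTE ny) cats0; exists (Var y); first by left.
    by constructor; rewrite perm_sym.
  move/perm_single=> -[[-> ->]] /eqP; rewrite -size_eq0 size_cat addn_eq0 size_map !size_eq0.
  move=> /andP[/eqP b0 /eqP ->]; rewrite {b}b0 in TK *; rewrite eqxx.
  case: K KS TK => [_ /tys_size//|k K] KS /tys_consE[t1 [t2 [H1 [H2 [a1 [a2 [T1 T2 p -> [Ea Ea2]]]]]]]].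
  move: T2; rewrite -Ea2 => T2; have /esym/size0nil EK := tys_size T2.
  move: T2; rewrite EK => /tys_nilE[E1 E2 _]; exists k; first by apply: KS; left.
  rewrite Ea E1 addn0; apply: ty_perm T1; rewrite perm_sym; apply: perm_trans p _.
  by rewrite E2 cats0.
- have [c [a' ->]] := dcons_seqE a.
  move/ty_lamE=> [s' -> T] pG aG KS TK.
  have pG' : perm_eq (assign 0 c ++ ren S G)
               (assign x.+1 b ++ (assign 0 c ++ ren S G')).
    have := ren_perm S pG; rewrite ren_cat ren_assign => {}pG; perm_solve.
  have aG' : absent x.+1 (assign 0 c ++ ren S G').
    by rewrite absent_cat absent_assign // absentS_renS.
  have KS' : List.incl (map shift K) (map shift Ns).
    by move=> A /In_map[B BK ->]; apply/In_map; exists B => //; exact: KS.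
  have [M' M'M T'] := IH _ _ _ _ _ _ _ _ _ _ T pG' aG' KS' (tys_ren S TK).
  exists (Lam M'); first by apply/In_map; exists M'.
  by apply/ty_lamE; exists (s' + t) => //; rewrite ren_cat catA.
- move/ty_appE=> [s1 [s2 [G1 [G2 [c [T1 [K0 [c' [KN pc T2]]] p Es]]]]]] pG aG KS TK.
  rewrite perm_sym in pG.
  have [b1 [b2 [G3 [G4 [p1 p2 pb pG' [a1 a2]]]]]] := split_cat aG (perm_trans pG p).
  have [t1 [t2 [H1 [H2 [K1 [K2 [TK1 TK2 pH Et [KK1 KK2]]]]]]]] := tys_split pb TK.
  have [M' M'M T] := IHM _ _ _ _ _ _ _ _ _ _ T1 p1 a1 (List.incl_tran KK1 KS) TK1.
  have [|L' L'L T'] := tys_subst_of _ T2 p2 a2 (List.incl_tran KK2 KS) TK2.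
    by move=> B /In_cat[/IHL|/KN/IHN] HB; exact: HB.
  (* [L1] is one of the [choices] for the linear components. The promoted sum is not distributed, so
     the images [K'] of its copies are simply elements of the substituted sum. *)
  have [L1 [K' [E F1 F2]]] := Forall2_split L'L.
  exists (App M' (Bag L1 (flatten (map (subst x Ns) N)))).
    apply/In_allpairs; exists M', (Bag L1 (flatten (map (subst x Ns) N))); split=> //.
    apply/In_map; exists L1 => //; apply/In_choices; exact/Forall2_map_l.
  apply/ty_appE; exists (s1 + t1), (s2 + t2), (G3 ++ H1), (G4 ++ H2), c.
  split=> //; [|clear -pG' pH; perm_solve|lia].
  exists K', c'; split=> //; last by rewrite -E.
  move=> A /(Forall2_in_r F2)[k kK Ak]; apply/In_flatten; exists (subst x Ns k) => //.
  by apply/In_map; exists k => //; exact: KN.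
- move/ty_taubarE=> [s' [-> /= T ->]] pG aG KS TK.
  have [|L' L'L T'] := tys_subst_of _ T pG aG KS TK.
    by move=> B /IHL HB; exact: HB.
  exists (TauBar (Tau L')).
    apply/In_map; exists (Tau L') => //; apply/In_map; exists L' => //.
    by apply/In_choices; exact/Forall2_map_l.
  apply/ty_taubarE; exists (s' + t); split=> //=.
  by rewrite -(Forall2_length L'L).
Qed.

Lemma tys_subst_inv_of x Ns L :
  (forall M, List.In M L -> forall M' s G a,
     List.In M' (subst x Ns M) -> ty s G M' a ->
     exists s1 s2 G' H b K, [/\ perm_eq G (G' ++ H), absent x G', List.incl K Ns,
       ty s1 (assign x b ++ G') M a & tys s2 H K b]) ->
  forall L' s G c, List.Forall2 (fun M M' => List.In M' (subst x Ns M)) L L' ->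
    tys s G L' c ->
    exists s1 s2 G' H b K, [/\ perm_eq G (G' ++ H), absent x G', List.incl K Ns,
      tys s1 (assign x b ++ G') L c & tys s2 H K b].
Proof.
elim: L => [|M L IH] HL L' s G c F; inversion F as [|? M' ? L1 M'M F']; subst.
  move/tys_nilE=> [_ -> ->]; exists 0, 0, [::], [::], [::], [::]; split=> //;
    by [case | constructor].
move/tys_consE=> [t1 [t2 [G1 [G2 [a' [c' [T1 T2 p _ ->]]]]]]].
have [s1 [s2 [G3 [H1 [b1 [K1 [p1 a1 KS1 T1' TK1]]]]]]] :=
  HL _ (or_introl erefl) _ _ _ _ M'M T1.
have [|s3 [s4 [G4 [H2 [b2 [K2 [p2 a2 KS2 T2' TK2]]]]]]] := IH _ _ _ _ _ F' T2.
  by move=> M1 M1L; apply: HL; right.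
exists (s1 + s3), (s2 + s4), (G3 ++ G4), (H1 ++ H2), (b1 ++ b2), (K1 ++ K2).
split.
- perm_solve.
- by rewrite absent_cat a1.
- by move=> A /In_cat[/KS1|/KS2].
- apply: (tys_cons T1' T2') => //; perm_solve.
- exact: tys_cat.
Qed.

(** [K] and [b] collect, over the whole derivation, the inserted elements of [Ns] and the types at
    which they are used. A promoted position may contribute any number of them. *)
Lemma ty_subst_inv x Ns M M' s G a :
  List.In M' (subst x Ns M) -> ty s G M' a ->
  exists s1 s2 G' H b K, [/\ perm_eq G (G' ++ H), absent x G', List.incl K Ns,
    ty s1 (assign x b ++ G') M a & tys s2 H K b].
Proof.
elim/term_nested_ind: M x Ns M' s G a
    => [y|M IH|M L N IHM IHL IHN|L IHL] x Ns M' s G a /=.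
- case: eqP => [->|/eqP nyx].
    move=> M'Ns T; exists 0, s, [::], G, [:: a], [:: M']; split=> //.
    + by move=> A [<-|].
    + by constructor.
    + rewrite -(addn0 s); apply: (tys_cons T tys_nil) => //; by rewrite cats0.
  case=> [<-|//] /ty_varE[_ p].
  exists 0, 0, G, [::], [::], [::]; split=> //; try by [rewrite cats0 | case | constructor].
  by rewrite (absent_perm x p) /absent inE eq_sym.
- move/In_map=> [M0 M0M ->]; have [c [a' ->]] := dcons_seqE a.
  move/ty_lamE=> [s' _ T].
  have [s1 [s2 [G1 [H1 [b [K [p a1 KS T1 T2]]]]]]] := IH _ _ _ _ _ _ M0M T.
  have [K' K'Ns EK] := incl_map KS; rewrite {K KS}EK in T2.
  have [H2 p2 TK] := tys_ren_inv T2.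
  have [b1 [G2 p1]] := env_split0 G1.
  have : perm_eq (assign 0 c ++ ren S G) (assign 0 b1 ++ ren S (G2 ++ H2)).
    by rewrite ren_cat; perm_solve.
  case/split0_uniq=> pb pG; exists s1.+1, s2, G2, H2, b, K'; split=> //.
    by move: a1; rewrite (absent_perm _ p1) absent_cat absentS_renS => /andP[].
  apply/ty_lamE; exists s1 => //; apply: ty_perm T1.
  have {}pb := assign_perm 0 pb.
  rewrite ren_cat ren_assign; perm_solve.
- move/In_allpairs=> [M0 [P [M0M /In_map[L' /In_choices/Forall2_map_l L'L ->] ->]]].
  move/ty_appE=> [t1 [t2 [G1 [G2 [c [T1 [K0 [c' [KN pc T2]]] p _]]]]]].
  have [s1 [s2 [G3 [H1 [b1 [K1 [p1 a1 KS1 T1' TK1]]]]]]] := IHM _ _ _ _ _ _ M0M T1.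
  (* Each used element of the substituted promoted sum is traced back to the element of [N] that it
     comes from. *)
  have [K' K'N F] : exists2 K', List.incl K' N &
      List.Forall2 (fun M M' => List.In M' (subst x Ns M)) K' K0.
    elim: K0 KN {T2} => [|k K0 IH] KN; first by exists [::] => //; constructor.
    have [|K' K'N F] := IH; first by move=> A AK; apply: KN; right.
    have /In_flatten[_ /In_map[k' k'N ->] kk'] := KN k (or_introl erefl).
    by exists (k' :: K'); [move=> A [<-|/K'N] | constructor].
  have [|s3 [s4 [G4 [H2 [b2 [K2 [p2 a2 KS2 T2' TK2]]]]]]] :=
      tys_subst_inv_of _ (List.Forall2_app L'L F) T2.
    by move=> A /In_cat[/IHL|/K'N/IHN] HB; exact: HB.
  exists (s1 + s3).+1, (s2 + s4), (G3 ++ G4), (H1 ++ H2), (b1 ++ b2), (K1 ++ K2).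
  split; last exact: tys_cat.
  + perm_solve.
  + by rewrite absent_cat a1.
  + by move=> A /In_cat[/KS1|/KS2].
  + apply/ty_appE; exists s1, s3, (assign x b1 ++ G3), (assign x b2 ++ G4), c.
    split=> //; [by exists K', c' | perm_solve].
- move/In_map=> [V /In_map[L' /In_choices/Forall2_map_l L'L ->] ->].
  move/ty_taubarE=> [s' [_ /= T ->]].
  have [|s1 [s2 [G1 [H1 [b1 [K1 [p1 a1 KS1 T1' TK1]]]]]]] := tys_subst_inv_of _ L'L T.
    by move=> A /IHL HB; exact: HB.
  exists s1.+1, s2, G1, H1, b1, K1; split=> //.
  apply/ty_taubarE; exists s1; split=> //=.
  by rewrite (Forall2_length L'L).
Qed.

(** * Reduction *)

Lemma renK G : ren predn (ren S G) = G.
Proof. by rewrite /ren -map_comp -[RHS]map_id; apply: eq_map => -[]. Qed.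

(** Stated for an arbitrary initial sum [Ns], because the accumulator of the left fold [lsubsts]
    changes at each step. *)
Lemma ty_lsubsts0 L M Ns s G c a t H :
  List.In M Ns -> ty s (assign 0 c ++ G) M a -> tys t H L c ->
  exists2 M', List.In M' (lsubsts 0 (map shift L) Ns) & ty (s + t) (G ++ ren S H) M' a.
Proof.
elim: L M Ns s G c t H => [|A L IH] M Ns s G c t H MN T.
  by case/tys_nilE=> -> -> E; exists M => //; rewrite addn0 cats0; rewrite E in T.
move/tys_consE=> [t1 [t2 [H1 [H2 [d [c' [TA TL p -> Ec]]]]]]]; rewrite {c}Ec in T.
have [M1 M1M T1] := ty_lsubst T (perm_refl _) (ty_ren S TA).
have M1N : List.In M1 (flatten (map (lsubst 0 (shift A)) Ns)).
  by apply/In_flatten; exists (lsubst 0 (shift A) M) => //; apply/In_map; exists M.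
rewrite -/(assign 0 c') -catA in T1.
have [M' M'M T'] := IH _ _ _ _ _ _ _ M1N T1 TL.
exists M' => //; rewrite addnA; apply: ty_perm T'.
have := ren_perm S p; rewrite ren_cat => {}p; perm_solve.
Qed.

Lemma ty_lsubsts0_inv L M' Ns s G a :
  List.In M' (lsubsts 0 (map shift L) Ns) -> ty s G M' a ->
  exists M s1 s2 G1 G2 c, [/\ List.In M Ns, perm_eq G (G1 ++ ren S G2),
    ty s1 (assign 0 c ++ G1) M a & tys s2 G2 L c].
Proof.
elim: L M' Ns s G a => [|A L IH] M' Ns s G a MN T.
  exists M', s, 0, G, [::], [::]; split=> //; [by rewrite cats0 | by constructor].
have [M1 [s1 [s2 [G1 [G2 [c [M1N p T1 T2]]]]]]] := IH _ _ _ _ _ MN T.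
move/In_flatten: M1N => [_ /In_map[M0 M0N ->] M1M].
have [s3 [s4 [H1 [H2 [d [p1 T3 TA]]]]]] := ty_lsubst_inv M1M T1.
have [H3 p2 {}TA] := ty_ren_inv TA.
have [c1 [H4 p3]] := env_split0 H1.
(* [g] holds the uses of 0 left over by the linear substitutions; in a contracted redex they are
   supplied by the promoted sum. *)
have [g [G3 p4]] := env_split0 G1.
have : perm_eq (assign 0 (c ++ g) ++ ren S G3) (assign 0 c1 ++ ren S (H4 ++ H3)).
  by rewrite ren_cat; clear -p1 p2 p3 p4; perm_solve.
case/split0_uniq=> /(assign_perm 0) pc /(ren_perm S); rewrite ren_cat => pG.
exists M0, s3, (s4 + s2), (assign 0 g ++ ren S H4), (H3 ++ G2), (d :: c); split=> //.
- by rewrite ren_cat; clear -p p4 pG; perm_solve.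
- by apply: ty_perm T3; rewrite /=; clear -p3 pc; perm_solve.
- exact: tys_cons TA T2 (perm_refl _) erefl.
Qed.

(** Once the uses of 0 are replaced, the environment is a shifted one, on which renaming by [predn]
    undoes the shift. *)
Lemma ty_lower_subst0 M N s G b a t H K :
  ty s (assign 0 b ++ ren S G) M a -> List.incl K N -> tys t H K b ->
  exists2 M', List.In M' (map lower (subst 0 (map shift N) M)) & ty (s + t) (G ++ H) M' a.
Proof.
move=> T KN TK.
have KN' : List.incl (map shift K) (map shift N).
  by move=> A /In_map[B BK ->]; apply/In_map; exists B => //; exact: KN.
have [M' M'M T'] := ty_subst T (perm_refl _) (absent0_renS _) KN' (tys_ren S TK).
exists (lower M'); first by apply/In_map; exists M'.
by have := ty_ren predn T'; rewrite -ren_cat renK.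
Qed.

Lemma ty_lower_subst0_inv M N M' s G a :
  List.In M' (map lower (subst 0 (map shift N) M)) -> ty s G M' a ->
  exists s1 s2 G1 G2 K b, [/\ perm_eq G (G1 ++ G2), List.incl K N,
    ty s1 (assign 0 b ++ ren S G1) M a & tys s2 G2 K b].
Proof.
move/In_map=> [M1 M1M ->] /ty_ren_inv[G0 p T].
have [s1 [s2 [G1 [H [b [K [p1 a1 KN T1 T2]]]]]]] := ty_subst_inv M1M T.
have [K' K'N EK] := incl_map KN; rewrite {K KN}EK in T2.
have [H2 p2 TK] := tys_ren_inv T2.
exists s1, s2, (ren predn G1), H2, K', b; split=> //; last by rewrite -absent0E.
apply: (perm_trans p); rewrite -(renK H2) -ren_cat; apply: ren_perm.
by clear -p1 p2; perm_solve.
Qed.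

(** The size falls by two because the application and abstraction rules disappear, while both
    substitutions preserve the total size of the rest. *)
Lemma ty_beta M L N s G a : ty s G (App (Lam M) (Bag L N)) a ->
  exists M' s', [/\ List.In M' (beta M L N), s = s'.+2 & ty s' G M' a].
Proof.
move/ty_appE=> [s0 [s2 [G1 [G2 [b [/ty_lamE[s1 -> T1] [K [b' [KN pb T2]]] p Es]]]]]].
(* The types of the bag are divided into [c1], consumed by linear substitution of [L], and [c2],
   left for the substitution of [N]. *)
have [t1 [t2 [H1 [H2 [c1 [c2 [TL TK pH Et Eb]]]]]]] := tys_catE T2.
have {}T1 : ty s1 (assign 0 c1 ++ (assign 0 c2 ++ ren S G1)) M a.
  apply: ty_perm T1; have := assign_perm 0 pb; rewrite Eb => {}pb.
  by clear -pb; perm_solve.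
have [M1 M1M T3] := ty_lsubsts0 (or_introl erefl : List.In M [:: M]) T1 TL.
rewrite -catA -ren_cat in T3.
have [M' M'M T4] := ty_lower_subst0 T3 KN TK.
exists M', (s1 + t1 + t2); split; last first.
- by apply: ty_perm T4; clear -p pH; perm_solve.
- by lia.
- move/In_map: M'M => [M2 M2M ->]; apply/In_map; exists M2 => //; apply/In_flatten.
  by eexists; last exact: M2M; apply/In_map; exists M1.
Qed.

Lemma ty_beta_inv M L N M' s G a : List.In M' (beta M L N) -> ty s G M' a ->
  exists s', ty s' G (App (Lam M) (Bag L N)) a.
Proof.
move/In_map=> [M2 /In_flatten[_ /In_map[M1 M1M ->] M2M] ->] T.
have LM2 : List.In (lower M2) (map lower (subst 0 (map shift N) M1)).
  by apply/In_map; exists M2.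
have [s1 [s2 [G1 [G2 [K [b [p KN T1 TK]]]]]]] := ty_lower_subst0_inv LM2 T.
have [M0 [s3 [s4 [G3 [G4 [c [[<-|//] p1 T3 TL]]]]]]] := ty_lsubsts0_inv M1M T1.
have [b1 [G5 p2]] := env_split0 G3.
have : perm_eq (assign 0 b ++ ren S G1) (assign 0 b1 ++ ren S (G5 ++ G4)).
  by rewrite ren_cat; clear -p1 p2; perm_solve.
case/split0_uniq=> /(assign_perm 0) pb pG.
exists (s3.+1 + (s4 + s2)).+1; apply/ty_appE.
exists s3.+1, (s4 + s2), G5, (G4 ++ G2), (c ++ b); split=> //.
- apply/ty_lamE; exists s3 => //; apply: ty_perm T3; clear -p2 pb; perm_solve.
- by exists K, (c ++ b); split=> //; exact: tys_cat.
- by clear -p pG; perm_solve.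
Qed.

(** * Inclusion of points and soundness of reduction *)

Definition tm_le (M N : term) : Prop :=
  forall G a, (exists s, ty s G M a) -> exists s, ty s G N a.

Definition bag_le (P Q : bag) : Prop :=
  forall G b, (exists s, tybag s G P b) -> exists s, tybag s G Q b.

Definition tst_le (V W : test) : Prop :=
  forall G, (exists s, tytest s G V) -> exists s, tytest s G W.

Lemma tm_le_trans M N K : tm_le M N -> tm_le N K -> tm_le M K.
Proof. by move=> MN NK G a /MN/NK. Qed.

Lemma tm_le_lam M N : tm_le M N -> tm_le (Lam M) (Lam N).
Proof.
move=> MN G a; have [b [a' ->]] := dcons_seqE a.
case=> _ /ty_lamE[s _ T]; have [t T'] := MN _ _ (ex_intro _ s T).
by exists t.+1; apply/ty_lamE; exists t.
Qed.

Lemma tm_le_app M N P Q : tm_le M N -> bag_le P Q -> tm_le (App M P) (App N Q).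
Proof.
move=> MN PQ G a [s /ty_appE[s1 [s2 [G1 [G2 [b [T1 T2 p _]]]]]]].
have [|t1 T1'] := MN G1 (dcons (seq_mset b) a); first by exists s1.
have [|t2 T2'] := PQ G2 b; first by exists s2.
by exists (t1 + t2).+1; apply/ty_appE; exists t1, t2, G1, G2, b.
Qed.

Lemma tm_le_taubar V W : tst_le V W -> tm_le (TauBar V) (TauBar W).
Proof.
move=> VW G a [_ /ty_taubarE[s [_ T ->]]].
have [|t T'] := VW G; first by exists s.
by exists t.+1; apply/ty_taubarE; exists t.
Qed.

Lemma tys_le_head M M' L s G b : tm_le M M' -> tys s G (M :: L) b ->
  exists s', tys s' G (M' :: L) b.
Proof.
move=> MM' /tys_consE[s1 [s2 [G1 [G2 [a [c [T1 T2 p _ ->]]]]]]].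
have [|t1 T1'] := MM' G1 a; first by exists s1.
by exists (t1 + s2); exact: tys_cons T1' T2 p erefl.
Qed.

Lemma tys_le_sum N N' K s G b :
  (forall M, List.In M N -> exists2 M', List.In M' N' & tm_le M M') ->
  List.incl K N -> tys s G K b ->
  exists s' K', List.incl K' N' /\ tys s' G K' b.
Proof.
move=> NN'; elim: K s G b => [|k K IH] s G b KN.
  by move=> T; exists s, [::]; split.
move/tys_consE=> [s1 [s2 [G1 [G2 [a [c [T1 T2 p _ ->]]]]]]].
have [k' k'N /(_ G1 a) kk'] := NN' k (KN k (or_introl erefl)).
have [|t1 T1'] := kk'; first by exists s1.
have [|t2 [K' [K'N T2']]] := IH _ _ _ _ T2; first by move=> x xK; apply: KN; right.
exists (t1 + t2), (k' :: K'); split; first by move=> x [<-|/K'N].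
exact: tys_cons T1' T2' p erefl.
Qed.

Lemma bag_le_lin M M' L N : tm_le M M' -> bag_le (Bag (M :: L) N) (Bag (M' :: L) N).
Proof.
move=> MM' G b [s [K [b' [KN pb T]]]].
by have [s' T'] := tys_le_head MM' T; exists s', K, b'.
Qed.

(** One criterion covers the replacement of a promoted summand, the equality of sums as sets, and a
    step inside the promoted part, whose contractum may have several summands or none. *)
Lemma bag_le_sum L N N' :
  (forall M, List.In M N -> exists2 M', List.In M' N' & tm_le M M') ->
  bag_le (Bag L N) (Bag L N').
Proof.
move=> NN' G b [s [K [b' [KN pb]]]].
move/tys_catE=> [s1 [s2 [G1 [G2 [b1 [b2 [T1 T2 p _ Eb]]]]]]].
have [t2 [K' [K'N T2']]] := tys_le_sum NN' KN T2.
exists (s1 + t2), K', b'; split=> //; rewrite Eb.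
by apply: tys_perm_env (tys_cat T1 T2'); rewrite perm_sym.
Qed.

Lemma bag_le_perm L L' N : Permutation.Permutation L L' -> bag_le (Bag L N) (Bag L' N).
Proof.
move=> pL G b [s [K [b' [KN pb T]]]].
have [c pc T'] := tys_perm_terms (Permutation.Permutation_app_tail K pL) T.
by exists s, K, c; split=> //; exact: perm_trans pb pc.
Qed.

Lemma tst_le_elt M M' L : tm_le M M' -> tst_le (Tau (M :: L)) (Tau (M' :: L)).
Proof. by move=> MM' G [s /(tys_le_head MM')]. Qed.

Lemma tst_le_perm L L' : Permutation.Permutation L L' -> tst_le (Tau L) (Tau L').
Proof.
move=> pL G [s T]; exists s => /=; have [c pc T'] := tys_perm_terms pL T.
by have <- : c = nseq (size L') star; first by
  rewrite -(tys_size T'); apply/all_pred1P; rewrite -(perm_all _ pc) all_pred1_nseq.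
Qed.

Lemma tm_le_rename f M N : tm_le M N -> tm_le (rename f M) (rename f N).
Proof.
move=> MN G a [s /ty_ren_inv[G0 p T]].
have [|s' T'] := MN G0 a; first by exists s.
by exists s'; apply: ty_perm (ty_ren f T'); rewrite perm_sym.
Qed.

Scheme tm_eqv_mind := Minimality for tm_eqv Sort Prop
  with bag_eqv_mind := Minimality for bag_eqv Sort Prop
  with tst_eqv_mind := Minimality for tst_eqv Sort Prop.
Combined Scheme eqv_mind from tm_eqv_mind, bag_eqv_mind, tst_eqv_mind.

Scheme tm_step_mind := Minimality for tm_step Sort Prop
  with bag_step_mind := Minimality for bag_step Sort Prop
  with tst_step_mind := Minimality for tst_step Sort Prop.
Combined Scheme step_mind from tm_step_mind, bag_step_mind, tst_step_mind.

Lemma eqv_le :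
  (forall M M', tm_eqv M M' -> tm_le M M' /\ tm_le M' M) /\
  (forall P P', bag_eqv P P' -> bag_le P P' /\ bag_le P' P) /\
  (forall V V', tst_eqv V V' -> tst_le V V' /\ tst_le V' V).
Proof.
apply: eqv_mind.
- by move=> M; split=> G a.
- by move=> M M' _ [].
- by move=> M M' M'' _ [l1 l2] _ [l3 l4]; split; [exact: tm_le_trans l1 l3 | exact: tm_le_trans l4 l2].
- by move=> M M' _ [l1 l2]; split; exact: tm_le_lam.
- by move=> M M' P P' _ [l1 l2] _ [l3 l4]; split; exact: tm_le_app.
- by move=> V V' _ [l1 l2]; split; exact: tm_le_taubar.
- by move=> P; split=> G a.
- by move=> P P' _ [].
- by move=> P P' P'' _ [l1 l2] _ [l3 l4]; split=> G b => [/l1/l3|/l4/l2].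
- by move=> M M' L N _ [l1 l2]; split; exact: bag_le_lin.
- move=> M M' L N _ [l1 l2]; split; apply: bag_le_sum => A [<-|AN].
  + by exists M'; [left|].
  + by exists A; [right|].
  + by exists M; [left|].
  + by exists A; [right|].
- by move=> L L' N pL; split; apply: bag_le_perm => //; exact: Permutation.Permutation_sym.
- by move=> L N N' NN' N'N; split; apply: bag_le_sum => A AN; exists A => //; [exact: NN'|exact: N'N].
- by move=> V; split=> G.
- by move=> V V' _ [].
- by move=> V V' V'' _ [l1 l2] _ [l3 l4]; split=> G => [/l1/l3|/l4/l2].
- by move=> M M' L _ [l1 l2]; split; exact: tst_le_elt.
- by move=> L L' pL; split; apply: tst_le_perm => //; exact: Permutation.Permutation_sym.
Qed.

(** The inclusion goes from each summand of the contractum to the redex, so a rule yielding 0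
    satisfies it vacuously. The rules working modulo equivalence compose it with [eqv_le] on the
    side of the redex and on that of the contractum. *)
Lemma step_le :
  (forall M Ns, tm_step M Ns -> forall M', List.In M' Ns -> tm_le M' M) /\
  (forall P Ps, bag_step P Ps -> forall P', List.In P' Ps -> bag_le P' P) /\
  (forall V Vs, tst_step V Vs -> forall V', List.In V' Vs -> tst_le V' V).
Proof.
have [tm_eqv_le [bag_eqv_le tst_eqv_le]] := eqv_le.
apply: step_mind.
- by move=> M L N M' M'M G a [s T]; exact: ty_beta_inv M'M T.
(* [TauBar V] has only the type [star], which is also [[] :: star]; the bag is then typed with no
   copies and no types. *)
- move=> V N _ [<-|//] G a [s T]; exists (s + 0).+1; apply/ty_appE.
  move/ty_taubarE: (T) => [s' [_ _ Ea]].
  exists s, 0, G, [::], [::]; rewrite cats0; split=> //.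
    by rewrite Ea dcons_nil_star -Ea.
  by exists [::], [::]; split=> //; constructor.
- by [].
- by move=> M Ns _ IH _ /In_map[M' /IH le ->]; exact: tm_le_lam.
- by move=> M Ns P _ IH _ /In_map[M' /IH le ->]; apply: tm_le_app => // G b.
- by move=> M P Ps _ IH _ /In_map[P' /IH le ->]; apply: tm_le_app => // G b.
- by move=> V Vs _ IH _ /In_map[V' /IH le ->]; exact: tm_le_taubar.
- move=> M M' Ns Ns' /tm_eqv_le[_ le] _ IH [_ E] A /E[B /IH le' /tm_eqv_le[_ le'']].
  exact: tm_le_trans le'' (tm_le_trans le' le).
- by move=> M Ns L N _ IH _ /In_map[M' /IH le ->]; exact: bag_le_lin.
- move=> M Ns L N _ IH _ [<-|//]; apply: bag_le_sum => A /In_cat[/IH le|AN].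
    by exists M; [left|].
  by exists A; [right|].
- move=> P P' Ps Ps' /bag_eqv_le[_ le] _ IH [_ E] A /E[B /IH le' /bag_eqv_le[_ le'']].
  by move=> G b /le''/le'/le.
- move=> M L _ /In_map[M' M'M ->] G [s /= /tys_consE[s1 [s2 [G1 [G2 [a [c [T1 T2 p _ [Ea Ec]]]]]]]]]; subst a c.
  have [t1 [t2 [G3 [G4 [K [b [p' KN T3 TK]]]]]]] := ty_lower_subst0_inv (N := [::]) M'M T1.
  (* The substituted sum is 0, so no copy is available and the bound variable has no types; the
     abstraction gets [[] :: star], that is [star]. *)
  case: K KN TK => [_|k K /(_ k (or_introl erefl))//] /tys_nilE[_ E4 Eb].
  exists (t1.+1 + s2) => /=; apply: (tys_cons _ T2) => //; last exact: p.
  rewrite -dcons_nil_star; apply/ty_lamE; exists t1 => //; apply: ty_perm T3.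
  rewrite Eb E4 cats0 in p' *; rewrite perm_sym; exact: ren_perm.
- move=> K L _ [<-|//] G [s /=]; rewrite size_cat nseqD => T.
  have [s1 [s2 [G1 [G2 [b1 [b2 [T1 T2 p Es E]]]]]]] := tys_catE T.
  have [Eb1 Eb2] : nseq (size K) star = b1 /\ nseq (size L) star = b2.
    by apply: cat_inj E; rewrite size_nseq -(tys_size T1).
  exists (s1.+1 + s2); subst b1 b2; apply: (tys_cons _ T2 p) => //.
  by apply/ty_taubarE; exists s1.
- by move=> M Ns L _ IH _ /In_map[M' /IH le ->]; exact: tst_le_elt.
- move=> V V' Vs Vs' /tst_eqv_le[_ le] _ IH [_ E] A /E[B /IH le' /tst_eqv_le[_ le'']].
  by move=> G /le''/le'/le.
Qed.

Lemma tests_steps_le S S' V' G : tests_steps S S' -> List.In V' S' ->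
  (exists s, tytest s G V') -> exists2 V, List.In V S & exists s, tytest s G V.
Proof.
have [_ [_ tst_eqv_le]] := eqv_le; have [_ [_ tst_step_le]] := step_le.
move=> st; elim: st V' => {S S'} [S S' [_ E] V'|S S1 S2 st _ IH V' VS T].
  by move=> /E[V VS /tst_eqv_le[_ le]] T; exists V => //; exact: le.
have [V1 V1S1 T1] := IH _ VS T; case: st => V [Vs [R [[_ E1] st [_ E2]]]].
have [V2 /In_cat V2in /tst_eqv_le[_ le]] := E2 _ V1S1.
case: V2in => [/(tst_step_le _ _ st) le'|V2R].
  have [V3 V3S /tst_eqv_le[_ le3]] := E1 V (or_introl erefl).
  by exists V3 => //; apply/le3/le'/le.
have [V3 V3S /tst_eqv_le[_ le3]] := E1 V2 (or_intror V2R).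
by exists V3 => //; apply/le3/le.
Qed.

Lemma converges_ty V : converges V -> exists s, tytest s [::] V.
Proof.
case=> S /tests_steps_le /(_ (or_introl erefl)) H.
by have [|V' [<-|//]] := H [::]; first by exists 0; constructor.
Qed.

(** * Convergence of tests with a derivation *)

Lemma sum_eqv_refl S : sum_eqv tst_eqv S S.
Proof. by split=> V VS; exists V => //; constructor. Qed.

Lemma tests_steps_cat S S' R :
  tests_steps S S' -> tests_steps (S ++ R) (S' ++ R).
Proof.
have catE T T' : sum_eqv tst_eqv T T' -> sum_eqv tst_eqv (T ++ R) (T' ++ R).
  move=> [E1 E2]; split=> V /In_cat[].
  + by move=> /E1[V' V'T e]; exists V' => //; apply/In_cat; left.
  + by move=> VR; exists V; [apply/In_cat; right | constructor].
  + by move=> /E2[V' V'T e]; exists V' => //; apply/In_cat; left.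
  + by move=> VR; exists V; [apply/In_cat; right | constructor].
elim=> {S S'} [S S' E|S S1 S2 [V [Vs [Q [E1 st E2]]]] _ IH].
  by apply: steps_refl; exact: catE.
apply: steps_trans IH; exists V, Vs, (Q ++ R); split=> //.
  exact: catE E1.
by rewrite catA; exact: catE.
Qed.

(** Convergence only asks for [eps] among the summands, so one convergent summand suffices and the
    others are carried along. *)
Lemma converges_step V Vs V' :
  tst_step V Vs -> List.In V' Vs -> converges V' -> converges V.
Proof.
move=> st V'V [S cv]; exists (S ++ Vs).
(* By idempotency [Vs] equals [V' :: Vs], so [V'] can be reduced beside an intact copy of [Vs]. *)
apply: (@steps_trans _ ([:: V'] ++ Vs)); last exact: (tests_steps_cat Vs cv).
exists V, Vs, [::]; split=> //; first exact: sum_eqv_refl.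
rewrite cats0; split=> W WV.
  by exists W; [right | constructor].
by case: WV => [<-|WV]; [exists V' | exists W] => //; constructor.
Qed.

Lemma dcons_eq_star b a : dcons (seq_mset b) a = star -> b = [::] /\ a = star.
Proof.
by rewrite -{1}dcons_nil_star => /dcons_seq_inj[/perm_nilP-> ->].
Qed.

(* A head variable is impossible because the environment is empty. *)
Lemma ty_head M s a : ty s [::] M a ->
  [\/ exists M0, M = Lam M0, exists V, M = TauBar V |
      exists Ns M' s', [/\ tm_step M Ns, List.In M' Ns, s' < s & ty s' [::] M' a]].
Proof.
elim/term_nested_ind: M s a => [x|M _|M L N IH _ _|L _] s a.
- by move/ty_varE=> [_ /perm_size].
- by move=> _; constructor 1; exists M.
- move=> T; constructor 3; move/ty_appE: (T) => [s1 [s2 [G1 [G2 [b [T1 TB p Es]]]]]].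
  have [E1 E2] : G1 = [::] /\ G2 = [::].
    by move: p; rewrite perm_sym => /perm_nilP; case: G1 {T1}; case: G2 {TB}.
  subst G1 G2.
  case: (IH _ _ T1) => [[M0 EM]|[V EM]|[Ns [M' [s' [st M'N lt T']]]]].
  + subst M; have [M' [s' [M'M E T']]] := ty_beta T.
    exists (beta M0 L N), M', s'; split=> //; [exact: step_beta | lia].
  + subst M; move/ty_taubarE: T1 => [s' [E1 TV /dcons_eq_star[Eb Ea]]].
    (* The function has type [star], which leaves the bag no types; hence [L] is empty and the rule
       reducing to 0 does not apply. *)
    move: TB => [K [b' [_ pb TB]]]; rewrite Eb perm_sym in pb.
    have /tys_size Esz := TB; rewrite (perm_nilP pb) in Esz.
    case: L {T} TB Esz => [TB _|//].
    exists [:: TauBar V], (TauBar V), s1; split; [exact: step_taubar_nil|by left|lia|].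
    by rewrite E1; apply/ty_taubarE; exists s'.
  + exists [seq App M' (Bag L N) | M' <- Ns], (App M' (Bag L N)), (s' + s2).+1.
    split; [exact: step_app_l | by apply/In_map; exists M' | lia |].
    by apply/ty_appE; exists s', s2, [::], [::], b.
- by move=> _; constructor 2; exists (Tau L).
Qed.

Lemma ty_converges V s : tytest s [::] V -> converges V.
Proof.
elim/ltn_ind: s V => s IH [[|M L]] /=.
  by move=> _; exists [::]; apply: steps_refl; exact: sum_eqv_refl.
move/tys_consE=> [s1 [s2 [G1 [G2 [a [c [T1 T2 p Es [Ea Ec]]]]]]]].
have [E1 E2] : G1 = [::] /\ G2 = [::].
  by move: p; rewrite perm_sym => /perm_nilP; case: G1 {T1}; case: G2 {T2}.
subst G1 G2 a c.
case: (ty_head T1) => [[M0 EM]|[[K] EM]|[Ns [M' [s' [st M'N lt T']]]]].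
(* Reading [star] as [[] :: star], the derivation of the body makes no use of the bound variable, so
   it survives the substitution of the empty sum. *)
- subst M; move: T1; rewrite -dcons_nil_star => /ty_lamE[s' E T1].
  have [M' M'M T'] := ty_lower_subst0 (N := [::]) (G := [::]) T1 (List.incl_nil_l _) tys_nil.
  apply: (converges_step (step_tau_lam M0 L) (V' := Tau (M' :: L))).
    by apply/In_map; exists M'.
  apply: (IH (s' + 0 + s2)); first by lia.
  exact: (tys_cons T' T2 _ erefl).
- subst M; move/ty_taubarE: T1 => [s' [E TK _]].
  apply: (converges_step (step_tau_taubar K L) (V' := Tau (K ++ L))); first by left.
  apply: (IH (s' + s2)); first by lia.
  by rewrite /= size_cat nseqD; exact: tys_cat TK T2.
- apply: (converges_step (step_tau L st) (V' := Tau (M' :: L))).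
    by apply/In_map; exists M'.
  by apply: (IH (s' + s2)); [lia | exact: (tys_cons T' T2 _ erefl)].
Qed.

(** * Definability *)

Scheme tmctx_mind := Induction for tmctx Sort Prop
  with tstctx_mind := Induction for tstctx Sort Prop.
Combined Scheme ctx_mind from tmctx_mind, tstctx_mind.

(** Capture causes no difficulty: [tm_le] ranges over all environments, and [lam] is a renaming
    followed by [Lam]. *)
Lemma plug_le M N : tm_le M N ->
  (forall Dc, tm_le (plug Dc M) (plug Dc N)) /\
  (forall C, tst_le (plug_test C M) (plug_test C N)).
Proof.
move=> MN; apply: ctx_mind => //=.
- by move=> x Dc IH; apply: tm_le_lam; exact: tm_le_rename.
- by move=> Dc IH P; apply: tm_le_app => // G b.
- by move=> K Dc IH L Ns; apply: tm_le_app; [move=> G a | exact: bag_le_lin].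
- move=> K L Dc IH Ns; apply: tm_le_app; first by move=> G a.
  apply: bag_le_sum => A [<-|AN]; first by exists (plug Dc N); [left|].
  by exists A; [right|].
- by move=> C IH; exact: tm_le_taubar.
- by move=> Dc IH L; exact: tst_le_elt.
Qed.

Lemma mem_fvs L x : x \in flatten (map fv L) <-> exists2 A, List.In A L & x \in fv A.
Proof.
elim: L => [|M L IH] /=; first by split=> [|[]].
rewrite mem_cat; split=> [/orP[xM|/IH[A AL xA]]|[A [<-|AL] xA]].
- by exists M; [left|].
- by exists A; [right|].
- by rewrite xA.
- by apply/orP; right; apply/IH; exists A.
Qed.

Lemma fv_rename f M x : x \in fv (rename f M) -> exists2 y, y \in fv M & x = f y.
Proof.
have lst L : (forall M, List.In M L -> forall f x, x \in fv (rename f M) ->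
    exists2 y, y \in fv M & x = f y) ->
  forall f x, x \in flatten (map fv (map (rename f) L)) ->
    exists2 y, y \in flatten (map fv L) & x = f y.
  move=> HL g z /mem_fvs[_ /In_map[A AL ->]] /(HL A AL)[y yA ->].
  by exists y => //; apply/mem_fvs; exists A.
elim/term_nested_ind: M f x => [y|M IH|M L N IHM IHL IHN|L IHL] f x /=.
- by rewrite inE => /eqP ->; exists y; rewrite ?inE.
- case/mapP=> z; rewrite mem_filter => /andP[z0 /IH[y yM Ez]] ->.
  case: y yM Ez z0 => [|y] yM -> //= _; exists y => //.
  by apply/mapP; exists y.+1 => //; rewrite mem_filter.
- rewrite !mem_cat => /or3P[/IHM[y yM ->]|/(lst L IHL)[y yL ->]|/(lst N IHN)[y yN ->]].
  + by exists y; rewrite ?mem_cat ?yM.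
  + by exists y; rewrite ?mem_cat ?yL ?orbT.
  + by exists y; rewrite ?mem_cat ?yN ?orbT.
- exact: lst.
Qed.

Lemma tys_fv_of L :
  (forall M, List.In M L -> forall s G a, ty s G M a ->
     {subset [seq p.1 | p <- G] <= fv M}) ->
  forall s G b, tys s G L b -> {subset [seq p.1 | p <- G] <= flatten (map fv L)}.
Proof.
elim: L => [|M L IH] HL s G b; first by move/tys_nilE=> [_ -> _].
move/tys_consE=> [s1 [s2 [G1 [G2 [a [c [T1 T2 p _ _]]]]]]] x.
rewrite (perm_mem (perm_map fst p)) map_cat !mem_cat => /orP[xG|xG].
  by rewrite (HL _ (or_introl erefl) _ _ _ T1).
by rewrite (IH _ _ _ _ T2) ?orbT // => M1 M1L; apply: HL; right.
Qed.

Lemma ty_fv s G M a : ty s G M a -> {subset [seq p.1 | p <- G] <= fv M}.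
Proof.
elim/term_nested_ind: M s G a => [y|M IH|M L N IHM IHL IHN|L IHL] s G a.
- by move/ty_varE=> [_ p] x; rewrite (perm_mem (perm_map fst p)).
- have [b [a' ->]] := dcons_seqE a; move/ty_lamE=> [s' _ /IH T] x /mapP[[y d] yG ->] /=.
  apply/mapP; exists y.+1 => //; rewrite mem_filter /=; apply: T.
  rewrite map_cat mem_cat; apply/orP; right; rewrite /ren -map_comp.
  by apply/mapP; exists (y, d).
- move/ty_appE=> [s1 [s2 [G1 [G2 [b [T1 [K [b' [KN _ T2]]] p _]]]]]] x.
  rewrite (perm_mem (perm_map fst p)) map_cat /= !mem_cat => /orP[/(IHM _ _ _ T1)->//|xG].
  have : x \in flatten (map fv (L ++ K)).
    by apply: tys_fv_of T2 _ xG => A /In_cat[/IHL|/KN/IHN].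
  rewrite map_cat flatten_cat mem_cat => /orP[->|/mem_fvs[A AK xA]]; rewrite ?orbT //.
  apply/orP; right; apply/orP; right; apply/mem_fvs; exists A => //; exact: KN.
- by move/ty_taubarE=> [s' [_ /= T _]]; exact: tys_fv_of T.
Qed.

(** Used for bags of arguments that force a function to have [b] as the first component of its
    type. *)
Definition defines (Q : seq term) (b : seq D) : Prop :=
  forall G c, (exists s, tys s G Q c) <-> c = b /\ G = [::].

Lemma ty_app_defines Q b G M a : defines Q b ->
  (exists s, ty s G (App M (Bag Q [::])) a) <->
  (exists s, ty s G M (dcons (seq_mset b) a)).
Proof.
move=> Qb; split=> [[s /ty_appE[s1 [s2 [G1 [G2 [c [T1 [K [c' [KN pc T2]]] p _]]]]]]]|[s T]].
  case: K KN T2 => [_|k K /(_ k (or_introl erefl))//]; rewrite cats0 => T2.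
  have [Ec E2] := (Qb G2 c').1 (ex_intro _ _ T2); subst c' G2.
  rewrite cats0 in p; rewrite (seq_mset_perm pc) in T1.
  by exists s1; apply: ty_perm T1; rewrite perm_sym.
have [s2 T2] := (Qb [::] b).2 (conj erefl erefl).
exists (s + s2).+1; apply/ty_appE; exists s, s2, G, [::], b; split=> //.
  by exists [::], b; split=> //; rewrite cats0.
by rewrite cats0.
Qed.

Lemma tst_nilE G : (exists s, tytest s G (Tau [::])) <-> G = [::].
Proof.
by split=> [[s /= /tys_nilE[]]|->] //; exists 0; constructor.
Qed.

Lemma tys_defines_seq (b : seq D) :
  (forall x, x \in b -> exists2 P, fv P = [::] &
     forall G a, (exists s, ty s G P a) <-> a = x /\ G = [::]) ->
  exists2 Q, flatten (map fv Q) = [::] & defines Q b.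
Proof.
elim: b => [|x b IH] H.
  exists [::] => // G c; split=> [[s /tys_nilE[_ -> ->]]//|[-> ->]].
  by exists 0; constructor.
have [|Q fQ Qb] := IH; first by move=> y yb; apply: H; rewrite inE yb orbT.
have [P fP Px] := H x (mem_head _ _).
exists (P :: Q); first by rewrite /= fP.
move=> G c; split=> [[s /tys_consE[s1 [s2 [G1 [G2 [a [c' [T1 T2 p _ ->]]]]]]]]|[-> ->]].
  have [-> E1] := (Px G1 a).1 (ex_intro _ _ T1).
  have [-> E2] := (Qb G2 c').1 (ex_intro _ _ T2); subst G1 G2.
  by split=> //; apply/perm_nilP.
have [s1 T1] := (Px [::] x).2 (conj erefl erefl).
have [s2 T2] := (Qb [::] b).2 (conj erefl erefl).
by exists (s1 + s2); apply: (tys_cons T1 T2).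
Qed.

(** Dual to [tys_defines_seq]: the terms of [Q] are the components of a test on the variable 0, and
    each of them accounts for one of its uses. *)
Lemma tys_test_seq (b : seq D) :
  (forall x, x \in b -> exists2 P, {subset fv P <= [:: 0]} &
     forall G, (exists s, ty s G P star) <-> perm_eq G [:: (0, x)]) ->
  exists2 Q, {subset flatten (map fv Q) <= [:: 0]} &
    forall G, (exists s, tys s G Q (nseq (size Q) star)) <-> perm_eq G (assign 0 b).
Proof.
elim: b => [|x b IH] H.
  exists [::] => // G; split=> [[s /tys_nilE[_ -> _]]//|/perm_nilP->].
  by exists 0; constructor.
have [|Q fQ Qb] := IH; first by move=> y yb; apply: H; rewrite inE yb orbT.
have [P fP Px] := H x (mem_head _ _).
exists (P :: Q); first by move=> y; rewrite /= mem_cat => /orP[/fP|/fQ].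
move=> G; split=> [[s /tys_consE[s1 [s2 [G1 [G2 [a [c' [T1 T2 p _ [Ea Ec]]]]]]]]]|pG].
  subst a c'; have p1 := (Px G1).1 (ex_intro _ _ T1).
  have p2 := (Qb G2).1 (ex_intro _ _ T2).
  perm_solve.
have [s1 T1] := (Px [:: (0, x)]).2 (perm_refl _).
have [s2 T2] := (Qb (assign 0 b)).2 (perm_refl _).
by exists (s1 + s2); apply: (tys_cons T1 T2).
Qed.

(* The paper's test-context and term attached to [d], the latter generalized by
   an extra test [K] so that it can be built by recursion on [d]. *)
Lemma point_definable (d : D) :
  (exists2 Ps : seq bag, (forall P, List.In P Ps -> fv_bag P = [::]) &
     forall M G, (exists s, ty s G (foldl App M Ps) star) <-> (exists s, ty s G M d)) /\
  (forall K : seq term, exists2 P, {subset fv P <= flatten (map fv K)} &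
     forall G a, (exists s, ty s G P a) <-> a = d /\ exists s, tytest s G (Tau K)).
Proof.
elim/D_nested_ind: d => [|b d IHb [[Ps fPs HPs] HP]].
  split; first by exists [::].
  move=> K; exists (TauBar (Tau K)) => // G a; split.
    by move=> [_ /ty_taubarE[s [_ T ->]]]; split=> //; exists s.
  by move=> [-> [s T]]; exists s.+1; apply/ty_taubarE; exists s.
rewrite -(seq_mset_id b); split.
  (* The second half of the hypothesis, taken with the empty test, gives closed terms for the
     elements of [b]; they form the first argument, and [Ps] probes the rest [d]. *)
  have [x xb|Q fQ Qb] := @tys_defines_seq b.
    have [_ /(_ [::])[P fP Px]] := IHb x xb.
    exists P; first by case: (fv P) fP => // y l /(_ y (mem_head _ _)).
    by move=> G a; rewrite Px tst_nilE.
  exists (Bag Q [::] :: Ps); first by move=> P [<-|/fPs //] /=; rewrite fQ.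
  by move=> M G /=; rewrite HPs; exact: ty_app_defines.
move=> K.
have [x xb|Q fQ Qb] := @tys_test_seq b.
  have [[Ps' fPs' HPs'] _] := IHb x xb.
  (* The arguments that probe for [x], applied to the variable 0: the result has type [star] exactly
     when 0 is used once, at [x]. *)
  exists (foldl App (Var 0) Ps').
    have : {subset fv (Var 0) <= [:: 0]} by [].
    elim: Ps' (Var 0) fPs' {HPs'} => //= P Ps' IH M H fM; apply: IH.
      by move=> P' P'Ps; apply: H; right.
    by move=> y /=; rewrite (H P (or_introl erefl)) cats0; exact: fM.
  move=> G; rewrite HPs'; split=> [[s /ty_varE[]]//|p].
  by exists 0; constructor.
(* The test [Q] on the new bound variable joins the shifted [K], and the recursion on [d] carries
   both under the remaining abstractions; this is why [K] is arbitrary. *)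
have [P fP HPK] := HP (map shift K ++ Q).
exists (Lam P).
  move=> x /mapP[y]; rewrite mem_filter => /andP[y0 /fP yK] ->.
  move: yK; rewrite map_cat flatten_cat mem_cat => /orP[|/fQ]; last first.
    by rewrite inE (negbTE y0).
  move=> /mem_fvs[_ /In_map[A AK ->]] /fv_rename[z zA ->] /=.
  by apply/mem_fvs; exists A.
move=> G a; have [c [a' ->]] := dcons_seqE a; split.
  move=> [s /ty_lamE[s' _ T]].
  have [-> [t /= ]] := (HPK _ _).1 (ex_intro _ _ T).
  rewrite size_cat nseqD => TT.
  have [s1 [s2 [G1 [G2 [b1 [b2 [T1 T2 p _ E]]]]]]] := tys_catE TT.
  have [Eb1 Eb2] : nseq (size (map shift K)) star = b1 /\ nseq (size Q) star = b2.
    by apply: cat_inj E; rewrite size_nseq -(tys_size T1).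
  subst b1 b2; have pQ := (Qb G2).1 (ex_intro _ _ T2).
  have [G3 p3 T3] := tys_ren_inv T1.
  have : perm_eq (assign 0 c ++ ren S G) (assign 0 b ++ ren S G3).
    by clear -p pQ p3; perm_solve.
  case/split0_uniq=> pc pG; split; first by rewrite (seq_mset_perm pc).
  by exists s1 => /=; rewrite size_map in T3; apply: tys_perm_env T3; rewrite perm_sym.
move=> [/dcons_seq_inj[pc ->] [s /= T]].
have [s2 T2] := (Qb (assign 0 b)).2 (perm_refl _).
have TT := tys_cat (tys_ren S T) T2.
have [|t T'] := (HPK (assign 0 c ++ ren S G) d).2.
  split=> //; exists (s + s2); rewrite /= size_cat size_map nseqD.
  apply: tys_perm_env TT; have {}pc := assign_perm 0 pc; clear -pc; perm_solve.
by exists t.+1; apply/ty_lamE; exists t.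
Qed.

Lemma defines_exists (b : seq D) :
  exists2 Q, flatten (map fv Q) = [::] & defines Q b.
Proof.
apply: tys_defines_seq => x _; have [_ /(_ [::])[P fP Px]] := point_definable x.
exists P; first by case: (fv P) fP => // y l /(_ y (mem_head _ _)).
by move=> G a; rewrite Px tst_nilE.
Qed.

(** The argument [Q] fixes the types at which the captured [x] must be used, and [x] is no longer
    free outside. *)
Lemma ty_lam_defines x M Q b G a : defines Q b ->
  (exists s, ty s G (App (lam x M) (Bag Q [::])) a) <->
  absent x G /\ (exists s, ty s (assign x b ++ G) M a).
Proof.
move=> Qb; rewrite (ty_app_defines _ _ _ Qb).
have renE H : absent x H -> ren (fun y => if y == x then 0 else y.+1) H = ren S H.
  move=> aH; apply/eq_in_map => -[y d] yH /=; case: eqP => // Ey.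
  by case/mapP: aH; exists (y, d).
split.
  move=> [s /ty_lamE[s' _ /ty_ren_inv[G0 p T]]].
  have [c [G1 [p0 a1]]] := env_split x G0.
  have := ren_perm (fun y => if y == x then 0 else y.+1) p0.
  rewrite ren_cat ren_assign eqxx (renE _ a1) => p1.
  have [pb pG] := split0_uniq (perm_trans p p1).
  split; first by rewrite (absent_perm _ pG).
  exists s'; apply: ty_perm T.
  have {}pb := assign_perm x pb; clear -pb pG p0; perm_solve.
move=> [aG [s T]]; exists s.+1; apply/ty_lamE; exists s => //.
have := ty_ren (fun y => if y == x then 0 else y.+1) T.
by rewrite ren_cat ren_assign eqxx renE.
Qed.

(** Each variable is abstracted and the abstraction is applied at once to a bag defining [B x], so
    the term in the hole must use [x] at exactly those types. *)
Lemma binding_ctx (B : nat -> seq D) (xs : seq nat) : uniq xs ->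
  exists Dc, forall M,
    {subset fv (plug Dc M) <= [seq y <- fv M | y \notin xs]} /\
    forall G a, (exists s, ty s G (plug Dc M) a) <->
      (forall x, x \in xs -> absent x G) /\
      (exists s, ty s (flatten [seq assign x (B x) | x <- xs] ++ G) M a).
Proof.
elim: xs => [_|x xs IH /= /andP[xxs /IH[Dc HD]]].
  exists CHole => M; split=> [y|G a] /=; first by rewrite filter_predT.
  by split=> [T|[]].
have [Q fQ Qb] := defines_exists (B x).
exists (CApp (CLam x Dc) (Bag Q [::])) => M; have [fD TD] := HD M; split.
  move=> y; rewrite /= fQ !cats0 => /mapP[z]; rewrite mem_filter => /andP[z0 /fv_rename[w wD Ez]] Ey.
  move: Ez; case: eqP => [_ Ez|nwx Ez]; first by rewrite Ez in z0.
  have -> : y = w by rewrite Ey Ez.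
  move: (fD _ wD); rewrite !mem_filter inE => /andP[wxs ->]; rewrite andbT negb_or wxs andbT.
  exact/eqP.
move=> G a; rewrite (ty_lam_defines _ _ _ _ Qb) TD; split.
  move=> [aG [H [s T]]]; split.
    move=> y; rewrite inE => /predU1P[->//|/H]; by rewrite absent_cat => /andP[].
  by exists s; apply: ty_perm T; rewrite /= perm_catCA -catA.
move=> [H [s T]]; split; first by apply: H; rewrite mem_head.
split; last by exists s; apply: ty_perm T; rewrite /= perm_sym perm_catCA -catA.
move=> y yxs; rewrite absent_cat H ?inE ?yxs ?orbT // andbT absent_assign //.
by apply: contraNneq xxs => <-.
Qed.

Lemma env_by_vars xs G : uniq xs -> {subset [seq p.1 | p <- G] <= xs} ->
  exists B, perm_eq G (flatten [seq assign x (B x) | x <- xs]).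
Proof.
elim: xs G => [|x xs IH] G /=.
  move=> _ H; exists (fun _ => [::]); case: G H => // p G /(_ p.1).
  by rewrite inE eqxx => /(_ isT).
move=> /andP[xxs /IH{}IH] sub; have [b [G' [p aG]]] := env_split x G.
have [|B pB] := IH G'.
  move=> y yG; have := sub y; rewrite (perm_mem (perm_map _ p)) map_cat mem_cat yG orbT.
  move=> /(_ isT); rewrite inE => /predU1P[Ey|//]; by rewrite Ey (negbTE aG) in yG.
exists (fun y => if y == x then b else B y); rewrite eqxx.
have -> : [seq assign y (if y == x then b else B y) | y <- xs] = [seq assign y (B y) | y <- xs].
  by apply/eq_in_map => y yxs; case: eqP => // Ey; rewrite -Ey yxs in xxs.
by apply: (perm_trans p); rewrite perm_cat2l.
Qed.

(** The context depends only on the point, not on the term in the hole, so the same one tests both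
    terms to be compared. *)
Lemma separating_ctx xs G d : uniq xs -> {subset [seq p.1 | p <- G] <= xs} ->
  exists C, forall M,
    ({subset fv M <= xs} -> fv_test (plug_test C M) = [::]) /\
    ((exists s, tytest s [::] (plug_test C M)) <-> exists s, ty s G M d).
Proof.
move=> uxs sub; have [B pB] := env_by_vars uxs sub.
have [Dc HD] := binding_ctx B uxs; have [[Ps fPs HPs] _] := point_definable d.
have plugE M : plug (foldl CApp Dc Ps) M = foldl App (plug Dc M) Ps.
  by elim: Ps Dc {HD fPs HPs} => //= P Ps IH Dc; rewrite IH.
exists (CTau (foldl CApp Dc Ps) [::]) => M; have [fD TD] := HD M; split.
  move=> fM; rewrite /= cats0 plugE.
  have : fv (plug Dc M) = [::].
    case: (fv _) fD => // y l /(_ y (mem_head _ _)).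
    by rewrite mem_filter => /andP[/negP nyx /fM].
  elim: Ps (plug Dc M) fPs {HPs plugE TD fD} => //= P Ps IH K H fK; apply: IH.
    by move=> P' P'Ps; apply: H; right.
  by rewrite /= fK H //; left.
rewrite /= plugE.
have -> : (exists s, tys s [::] [:: foldl App (plug Dc M) Ps] [:: star]) <->
          exists s, ty s [::] (foldl App (plug Dc M) Ps) star.
  split=> [[s /tys_consE[s1 [s2 [G1 [G2 [a [c [T1 /tys_nilE[_ E2 _] p _ [-> _]]]]]]]]]|[s T]].
    by exists s1; apply: ty_perm T1; rewrite perm_sym; rewrite E2 cats0 in p.
  by exists (s + 0); exact: (tys_cons T tys_nil _ erefl).
rewrite HPs TD cats0; split=> [[_ [s T]]|[s T]].
  by exists s; apply: ty_perm T; rewrite perm_sym.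
by split=> //; exists s; exact: ty_perm T.
Qed.

(** * Derivations and the interpretation *)

(** Entries for variables outside [xs] are dropped, so this is faithful only for environments over
    [xs]. *)
Definition proj n (xs : n.-tuple nat) (G : env) : n.-tuple {mset D}%mset :=
  [tuple of [seq seq_mset [seq p.2 | p <- G & p.1 == x] | x <- xs]].

Lemma seq_mset_cat (T : choiceType) (s t : seq T) :
  seq_mset (s ++ t) = (seq_mset s `+` seq_mset t)%mset.
Proof. by apply/msetP => x; rewrite msetE2 !mset_seqE count_cat. Qed.

Lemma seq_mset0 (T : choiceType) : seq_mset [::] = mset0 :> {mset T}%mset.
Proof. by rewrite -[RHS]seq_mset_id enum_mset0. Qed.

Lemma seq_mset1 (T : choiceType) (x : T) : seq_mset [:: x] = [mset x]%mset.
Proof. by apply/msetP => y; rewrite mset_seqE msetnE /= addn0 eq_sym; case: eqP. Qed.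

Lemma proj_cat n (xs : n.-tuple nat) G1 G2 :
  proj xs (G1 ++ G2) = tadd (proj xs G1) (proj xs G2).
Proof.
apply: eq_from_tnth => i; rewrite tnth_mktuple !tnth_map.
by rewrite filter_cat map_cat seq_mset_cat.
Qed.

Lemma proj_nil n (xs : n.-tuple nat) : proj xs [::] = tzero n.
Proof. by apply: eq_from_tnth => i; rewrite tnth_mktuple tnth_map seq_mset0. Qed.

Lemma proj_perm n (xs : n.-tuple nat) G G' : perm_eq G G' -> proj xs G = proj xs G'.
Proof.
move=> p; apply: eq_from_tnth => i; rewrite !tnth_map.
by apply: seq_mset_perm; apply: perm_map; exact: perm_filter.
Qed.

Lemma proj_var n (xs : n.-tuple nat) i a :
  uniq xs -> proj xs [:: (tnth xs i, a)] = tunit i a.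
Proof.
move=> uxs; apply: eq_from_tnth => j; rewrite tnth_mktuple tnth_map /=.
have -> : (tnth xs i == tnth xs j) = (j == i).
  by rewrite !(tnth_nth 0) nth_uniq ?size_tuple // eq_sym.
by case: eqP => _; rewrite ?seq_mset1 ?seq_mset0.
Qed.

(** The bound variable is last in [scope_lam xs] but first in the environment; as [proj] selects
    entries by variable, the two orders agree. *)
Lemma proj_lam n (xs : n.-tuple nat) b G :
  proj (scope_lam xs) (assign 0 b ++ ren S G) = textend (proj xs G) (seq_mset b).
Proof.
apply: val_inj; rewrite /= map_rcons -map_comp; congr rcons.
  apply: eq_map => x /=; congr seq_mset; rewrite filter_cat map_cat.
  have -> : [seq p <- assign 0 b | p.1 == x.+1] = [::] by elim: b.
  by rewrite /ren filter_map -map_comp.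
congr seq_mset; rewrite filter_cat (filter_assign 0 b).1.
rewrite (filter_absent (absent0_renS G)).1 cats0.
by rewrite /assign -map_comp map_id.
Qed.

Lemma proj_inj n (xs : n.-tuple nat) G G' :
  {subset [seq p.1 | p <- G] <= xs} -> {subset [seq p.1 | p <- G'] <= xs} ->
  proj xs G = proj xs G' -> perm_eq G G'.
Proof.
move=> sG sG' E.
have cnt H y d : count_mem (y, d) H = count_mem d [seq p.2 | p <- H & p.1 == y].
  by rewrite count_map count_filter; apply: eq_count => -[z e]; rewrite /= xpair_eqE andbC.
apply/allP => -[y d]; rewrite mem_cat => yd; apply/eqP.
have yxs : y \in xs.
  by case/orP: yd => yd; [apply: sG | apply: sG']; apply/mapP; exists (y, d).
rewrite !cnt; have /tnthP[i Ey] := yxs.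
have := congr1 (fun t => tnth t i) E; rewrite !tnth_map -Ey => /eq_seq_msetP /permP; exact.
Qed.

(** The condition on the variables of [G] mirrors the variable case of [sem], where a variable has
    points only if it is listed in [xs]. *)
Definition sem_spec n (xs : n.-tuple nat) (M : term) : Prop :=
  forall p, sem xs M p <-> exists s G,
    [/\ ty s G M p.2, {subset [seq q.1 | q <- G] <= xs} & p.1 = proj xs G].

Lemma sem_tys n (xs : n.-tuple nat) L qs :
  (forall M, List.In M L -> sem_spec xs M) ->
  List.Forall2 (fun M q => sem xs M q) L qs ->
  exists s G, [/\ tys s G L [seq q.2 | q <- qs], {subset [seq p.1 | p <- G] <= xs}
    & tsum [seq q.1 | q <- qs] = proj xs G].
Proof.
elim: L qs => [|M L IH] qs HL F; inversion F as [|? q ? qs' Mq F']; subst.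
  by exists 0, [::]; split=> //=; [constructor | rewrite proj_nil].
have [s1 [G1 [T1 v1 E1]]] := (HL M (or_introl erefl) q).1 Mq.
have [|s2 [G2 [T2 v2 E2]]] := IH _ _ F'; first by move=> N NL; apply: HL; right.
exists (s1 + s2), (G1 ++ G2); split=> /=; first exact: (tys_cons T1 T2).
  by move=> x; rewrite map_cat mem_cat => /orP[/v1|/v2].
by rewrite proj_cat -E1 -E2.
Qed.

Lemma tys_sem n (xs : n.-tuple nat) L s G b :
  (forall M, List.In M L -> sem_spec xs M) ->
  tys s G L b -> {subset [seq p.1 | p <- G] <= xs} ->
  exists qs, [/\ List.Forall2 (fun M q => sem xs M q) L qs, b = [seq q.2 | q <- qs]
    & tsum [seq q.1 | q <- qs] = proj xs G].
Proof.
elim: L s G b => [|M L IH] s G b HL.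
  by move=> /tys_nilE[_ -> ->] _; exists [::]; rewrite proj_nil; split.
move/tys_consE=> [s1 [s2 [G1 [G2 [a [c [T1 T2 p _ ->]]]]]]] sub.
have [v1 v2] : {subset [seq p.1 | p <- G1] <= xs} /\ {subset [seq p.1 | p <- G2] <= xs}.
  by split=> x xG; apply: sub; rewrite (perm_mem (perm_map _ p)) map_cat mem_cat xG ?orbT.
have [|qs [F -> E]] := IH _ _ _ _ T2 v2; first by move=> N NL; apply: HL; right.
exists ((proj xs G1, a) :: qs); split=> //=.
  by constructor=> //; apply/(HL M (or_introl erefl)); exists s1, G1.
by rewrite E -proj_cat; apply: proj_perm; rewrite perm_sym.
Qed.

Lemma sem_sumE T (Ss : seq (set T)) q :
  sem_sum Ss q <-> exists2 X, List.In X Ss & X q.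
Proof.
elim: Ss => [|X Ss IH] /=; first by split=> [|[]].
split=> [[Xq|/IH[Y YS Yq]]|[Y [<-|YS] Yq]].
- by exists X; [left|].
- by exists Y; [right|].
- by left.
- by right; apply/IH; exists Y.
Qed.

Lemma sem_bagE n (xs : n.-tuple nat) L N :
  (forall M, List.In M L -> sem_spec xs M) ->
  (forall M, List.In M N -> sem_spec xs M) ->
  forall p, sem_bag xs (Bag L N) p <-> exists s G c,
    [/\ tybag s G (Bag L N) c, {subset [seq q.1 | q <- G] <= xs},
        p.1 = proj xs G & p.2 = seq_mset c].
Proof.
move=> HL HN p; split.
  move=> [qs [ts [/Forall2_map_l F Ft E1 E2]]].
  (* Each point taken in the union over [N] comes from some summand; [K] records these choices in
     order. *)
  have [K KN FK] : exists2 K, List.incl K N & List.Forall2 (fun M q => sem xs M q) K ts.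
    elim: Ft {E1 E2} => [|q ts' /sem_sumE[_ /In_map[k kN ->] kq] _ [K KN FK]].
      by exists [::] => //; constructor.
    by exists (k :: K); [move=> A [<-|/KN] | constructor].
  have [|s [G [T v E]]] := sem_tys _ (List.Forall2_app F FK).
    by move=> M /In_cat[/HL|/KN/HN].
  exists s, G, [seq q.2 | q <- qs ++ ts]; split=> //; last by rewrite E1 -E.
  by exists K, [seq q.2 | q <- qs ++ ts].
move=> [s [G [c [[K [c' [KN pc T]]] v E1 E2]]]].
have [|qs [F Ec E]] := tys_sem _ T v; first by move=> M /In_cat[/HL|/KN/HN].
have [q1 [q2 [Eq F1 F2]]] := Forall2_split F.
exists q1, q2; split; last 2 first.
- by rewrite E1 -Eq E.
- by rewrite E2 -Eq -Ec; exact: seq_mset_perm.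
- exact/Forall2_map_l.
elim: F2 KN {T F Eq} => [|k q K' q2' kq _ IH] KN; constructor.
  apply/sem_sumE; exists (sem xs k) => //; apply/In_map; exists k => //.
  by apply: KN; left.
by apply: IH => A AK; apply: KN; right.
Qed.

Lemma sem_testE n (xs : n.-tuple nat) L :
  (forall M, List.In M L -> sem_spec xs M) ->
  forall a, sem_test xs (Tau L) a <-> exists s G,
    [/\ tytest s G (Tau L), {subset [seq q.1 | q <- G] <= xs} & a = proj xs G].
Proof.
move=> HL a; split.
  move=> [cs [/Forall2_map_l F ->]].
  have F' : List.Forall2 (fun M q => sem xs M q) L [seq (c, star) | c <- cs].
    by elim: F => //= *; constructor.
  have [s [G [T v E]]] := sem_tys HL F'.
  exists s, G; split=> //; last by rewrite -E -map_comp map_id.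
  move: T; rewrite -map_comp /=; have -> // : [seq star | _ <- cs] = nseq (size L) star.
  by rewrite (Forall2_length F); elim: cs {F F' E} => //= c cs ->.
move=> [s [G [/= T v ->]]]; have [qs [F Eb E]] := tys_sem HL T v.
exists [seq q.1 | q <- qs]; split=> //; apply/Forall2_map_l.
elim: F Eb {T HL E} => [|M [c d] L' qs' Mq _ IH] /=; first by constructor.
by move=> [Ed /IH]; constructor=> //; rewrite Ed.
Qed.

(** Uniqueness gives each variable one position, so that [tunit] is the projection of a one-entry
    environment. It passes under a binder because 0 is not a successor. *)
Lemma sem_ty n (xs : n.-tuple nat) M : uniq xs -> sem_spec xs M.
Proof.
elim/term_nested_ind: M n xs => [y|M IH|M L N IHM IHL IHN|L IHL] n xs uxs [a d] /=.
- split=> [[i Ei ->]|[s [G [/ty_varE[_ p] v ->]]]].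
    exists 0, [:: (y, d)]; split=> /=; first by constructor.
      by move=> x; rewrite inE => /eqP->; rewrite -Ei mem_tnth.
    by rewrite -Ei proj_var.
  have : y \in xs by apply: v; rewrite (perm_mem (perm_map _ p)) mem_head.
  by case/tnthP=> i Ei; exists i => //; rewrite (proj_perm xs p) Ei proj_var.
- have uxs' : uniq (scope_lam xs).
    rewrite /= rcons_uniq map_inj_uniq ?uxs ?andbT; last exact: succn_inj.
    by apply/mapP => -[].
  split=> [[b [c [Ms ->]]]|[s [G [T v ->]]]].
    have [s [G0 [T v E]]] := (IH _ _ uxs' (textend a b, c)).1 Ms.
    have [b' [G p]] := env_split0 G0.
    rewrite /= (proj_perm _ p) proj_lam in E.
    have /rcons_inj[/val_inj Ea Eb] := congr1 val E.
    exists s.+1, G; split=> //.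
      by rewrite Eb; apply/ty_lamE; exists s => //; exact: ty_perm T.
    move=> x xG; have : x.+1 \in scope_lam xs.
      apply: v; rewrite (perm_mem (perm_map _ p)) map_cat mem_cat; apply/orP; right.
      rewrite /ren -map_comp (map_comp S) mem_map //; exact: succn_inj.
    rewrite mem_rcons inE /= mem_map //; exact: succn_inj.
  have [b [c Ed]] := dcons_seqE d; rewrite Ed in T *.
  move/ty_lamE: T => [s' _ T]; exists (seq_mset b), c; split=> //.
  apply/(IH _ _ uxs'); exists s', (assign 0 b ++ ren S G); split=> //=; last by rewrite proj_lam.
  move=> x; rewrite map_cat mem_cat mem_rcons inE /assign -!map_comp => /orP[/mapP[? _ ->] //|].
  by move=> /mapP[q qG ->] /=; rewrite mem_map ?v ?map_f //; exact: succn_inj.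
- have BE := sem_bagE (fun A AL => IHL A AL n xs uxs) (fun A AN => IHN A AN n xs uxs).
  split=> [[a1 [a2 [b [Ms /BE[s2 [G2 [c [T2 v2 /= E2 Eb]]]] Ea]]]]|[s [G [T v ->]]]].
    have [s1 [G1 [T1 v1 E1]]] := (IHM _ _ uxs _).1 Ms.
    exists (s1 + s2).+1, (G1 ++ G2); split.
    + by apply/ty_appE; exists s1, s2, G1, G2, c; split=> //; rewrite -Eb.
    + by move=> x; rewrite map_cat mem_cat => /orP[/v1|/v2].
    + by rewrite proj_cat -E2 -E1.
  move/ty_appE: T => [s1 [s2 [G1 [G2 [b [T1 T2 p _]]]]]].
  have [v1 v2] : {subset [seq p.1 | p <- G1] <= xs} /\ {subset [seq p.1 | p <- G2] <= xs}.
    by split=> x xG; apply: v; rewrite (perm_mem (perm_map _ p)) map_cat mem_cat xG ?orbT.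
  exists (proj xs G1), (proj xs G2), (seq_mset b); split.
  + by apply/(IHM _ _ uxs); exists s1, G1.
  + by apply/BE; exists s2, G2, b.
  + by rewrite -proj_cat; exact: proj_perm.
- have TE := sem_testE (fun A AL => IHL A AL n xs uxs).
  split=> [[/TE[s [G [T v ->]]] ->]|[s [G [/ty_taubarE[s' [_ T ->]] v ->]]]].
    by exists s.+1, G; split=> //; apply/ty_taubarE; exists s.
  by split=> //; apply/TE; exists s', G.
Qed.

(** * Full abstraction *)

Local Open Scope classical_set_scope.

Theorem theorem8p12 (M N : term) (n : nat) (xs : n.-tuple nat)
    (xs_uniq : uniq xs)
    (fvM : {subset fv M <= xs}) (fvN : {subset fv N <= xs}) :
  sem xs M `<=` sem xs N <-> obs_le M N.
Proof.
split=> [MN C _ _ /converges_ty CM|MN [a d] /(sem_ty M xs_uniq)[s [G [/= T v ->]]]].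
  (* A derivation of [M] is sent to a point and back to a derivation of [N]; both environments are
     over [xs], so [proj_inj] identifies them. *)
  have le : tm_le M N.
    move=> G d [s T]; have v x := fun xG => fvM x (ty_fv T xG).
    have Mp : sem xs M (proj xs G, d) by apply/(sem_ty M xs_uniq); exists s, G.
    have [t [G' [T' v' E]]] := (sem_ty N xs_uniq _).1 (MN _ Mp).
    by exists t; apply: ty_perm T'; rewrite perm_sym; exact: proj_inj E.
  by have [s] := (plug_le le).2 C _ CM; exact: ty_converges.
(* The context is built for the given point of [M]; its convergence on [N] then amounts to a
   derivation of [N] with the same [G] and [d]. *)
have [C HC] := separating_ctx d xs_uniq v.
have [cM TM] := HC M; have [cN TN] := HC N.
have CM : converges (plug_test C M).
  by have [t] := TM.2 (ex_intro _ _ T); exact: ty_converges.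
have [t TN'] := TN.1 (converges_ty (MN C (cM fvM) (cN fvN) CM)).
by apply/(sem_ty N xs_uniq); exists t, G.
Qed.
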